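(* Let $w>0$, let $q_1\in C^2([0,\infty))$ be strictly monotone and let $g=q_1^{-1}$. Let $W:\mathbb{R}_+\times\mathbb{R}\to\mathbb{R}$ be a separable weighting of the form $W(E,t)=W_1(E)W_2(t)$, where $W_1\in C^1(\mathbb{R}_+)$ and $W_2\in C^1(\mathbb{R})$ are non-vanishing, and $W_2$ is bounded and has bounded first order derivative on $[-w,w]$. Assume that one of the following conditions holds: (i) $q_1$ is increasing, $q_1(0)=0$, and $q_1'>0$ on $[g(c_1),w]$, where $c_1=\frac{c_2E_m}{E_M}$ and $c_2=q_1(w)$; (ii) $q_1$ is decreasing, $q_1(0)>0$, $\lim_{t\to\infty}q_1(t)<0$, $w>g(0)$, and $q_1'<0$ on $[0,g(c_1)]$, where $c_1=\frac{c_2E_m}{E_M}$ and $c_2=q_1(0)$. Then the generalized Bragg transform $\mathfrak{B}_1$ is injective on $L^2_0(\mathfrak{E}\times\mathbb{R})$.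
   Context: Notation: $\mathbb{R}_+=(0,\infty)$, and $\mathfrak{E}=[E_m,E_M]$ with $0<E_m<E_M$ fixed. $L^2_0(\Omega)$ is the set of (real-valued) $L^2$ functions with compact support on $\Omega$; $f\in L^2_0(\mathfrak{E}\times\mathbb{R})$ is extended by zero to values of its first variable $q$ outside $\mathfrak{E}$ (including negative values). ''Non-vanishing'' means nowhere zero. The limit in (ii) may be $-\infty$. The generalized Bragg transform for $n=1$ (with curve $q_1$, weighting $W$ and constant width $w>0$), regarded as a linear map $\mathfrak{B}_1:L^2_0(\mathfrak{E}\times\mathbb{R})\to L^2(\mathbb{R}_+\times\mathbb{R})$, is $$\mathfrak{B}_1f(E,s)=\int_{\{x\in\mathbb{R}:\,|x-s|\le w\}}W(E,|x-s|)\,f(Eq_1(|x-s|),x)\,\mathrm{d}x,\qquad E\in\mathbb{R}_+,\ s\in\mathbb{R}.$$ Injectivity means: if $\mathfrak{B}_1f=0$ almost everywhere then $f=0$ almost everywhere. *)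

(* Defs.v *)
From HB Require Import structures.
From mathcomp Require Import all_boot all_order all_algebra.
From mathcomp Require Import all_classical all_reals all_analysis.

Set Implicit Arguments.
Unset Strict Implicit.
Unset Printing Implicit Defensive.

Import Order.TTheory GRing.Theory Num.Theory.
Import numFieldNormedType.Exports.

Local Open Scope classical_set_scope.
Local Open Scope ring_scope.

Section calculus_on_a_set.
Context {R : realType}.
Implicit Types (D : set R) (f : R -> R) (x : R).

(* The difference quotients of [derivable f x 1] and [derive1 f x], restricted
   to the increments that stay in D: one-sided at an endpoint of a closed
   interval, and the library's notions on an open set (see [derivable_on_open]
   and [derive_on_open]). *)
Definition derivable_on D f x : Prop :=
  cvg ((fun h => h^-1 *: (f (h + x) - f x)) @ within [set h | D (h + x)] 0^').

Definition derive_on D f x : R :=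
  lim ((fun h => h^-1 *: (f (h + x) - f x)) @ within [set h | D (h + x)] 0^').

Fixpoint class_C (k : nat) D f : Prop :=
  match k with
  | 0 => {within D, continuous f}
  | k'.+1 => (forall x, D x -> derivable_on D f x) /\
             class_C k' D (derive_on D f)
  end.

Definition strictly_increasing_on D f : Prop :=
  forall x y, D x -> D y -> x < y -> f x < f y.

Definition strictly_decreasing_on D f : Prop :=
  forall x y, D x -> D y -> x < y -> f y < f x.

Lemma within_increments_open D x : open D -> D x ->
  within [set h | D (h + x)] 0^' = 0^'.
Proof.
move=> oD Dx.
have H : \forall h \near (0 : R)^', D (h + x).
  apply: nbhs_dnbhs; have := open_nbhs_nbhs (conj oD Dx).
  by move=> /nbhs0P /=; apply: filterS => h; rewrite addrC.
apply/seteqP; split => A; rewrite /within /= => hA; near=> h.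
- have : D (h + x) by near: h.
  by near: h.
- by move=> _; near: h.
Unshelve. all: by end_near. Qed.

Lemma derivable_on_open D f x : open D -> D x ->
  derivable_on D f x <-> derivable f x 1.
Proof.
move=> oD Dx; rewrite /derivable_on within_increments_open// /derivable.
suff -> : (fun h : R => h^-1 *: (f (h + x) - f x)) =
    (fun h : R => h^-1 *: ((f \o shift x) (h *: (1 : R)) - f x)) by [].
by apply/funext => h /=; rewrite [h%:A]mulr1.
Qed.

Lemma derive_on_open D f x : open D -> D x -> derive_on D f x = derive1 f x.
Proof. by move=> oD Dx; rewrite /derive_on within_increments_open. Qed.

End calculus_on_a_set.

Section bragg_transform.
Context {R : realType}.
Local Notation mu := (@lebesgue_measure R).

(* Elements are Borel representatives on the whole plane, equal to 0 outside
   Omega; the support is the essential one, as for classes of functions. *)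
Definition L2_0 (Omega : set (R * R)) : set (R * R -> R) :=
  [set f | [/\ f \in Lfun (mu \x mu)%E 2%:E,
               (forall p, ~ Omega p -> f p = 0) &
               exists K : set (R * R),
                 [/\ compact K, K `<=` Omega &
                     ae_eq (mu \x mu)%E (~` K) f (cst 0)]]].

(* The real-valued integral is 0 by convention where the integrand is not
   integrable; under the hypotheses of the theorem this concerns only a null
   set of (E, s) in ]0, +oo[ x R. *)
Definition bragg (q1 : R -> R) (W : R -> R -> R) (w : R)
    (f : R * R -> R) (p : R * R) : R :=
  let: (E, s) := p in
  \int[mu]_(x in [set x | `|x - s| <= w])
    (W E `|x - s| * f (E * q1 `|x - s|, x)).

End bragg_transform.

(* Main.v *)
(* Only t = |x - s| and u = E q1(t) enter the kernel, so the bilateral Laplace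
   transform in s turns the Bragg transform into a one-dimensional Volterra
   equation whose kernel carries the weight cosh(n t).  Unlike cos(xi t), the
   weight given by the Fourier transform, it never vanishes.  Integrating over E
   in ]0, Y] as well, and writing A_n(v) for the integral of f(u, x) e^(n x) over
   u <= v, Fubini's theorem gives, for all Y in ]0, EM / c2],
     \int_0^w W2(t) 2 cosh(n t) A_n(Y q1(t)) / q1(t) dt = 0.
   As A_n vanishes on ]-oo, Em], only the t with q1(t) >= c1 matter, and there
   q1' does not vanish.  With Psi a primitive of A_n and
   H = 2 W2 cosh(n .) / (q1 q1'), integration by parts yields
     |H(d)| |Psi(Y c2)| = |\int H'(t) Psi(Y q1(t)) dt|,
   d being the endpoint where q1 = c2.  Comparing |Psi(v)| with v^N for N large
   forces Psi = 0, so that almost every section f(u, .) has vanishing exponential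
   moments of all orders n.  These determine a compactly supported function,
   because exp(- e^(k (x - a))), a series in the e^(k j x), tends to the indicator
   of ]-oo, a[ as k grows. *)
Require Import Defs.
From HB Require Import structures.
From mathcomp Require Import all_boot all_order all_algebra.
From mathcomp Require Import all_classical all_reals all_analysis.
From mathcomp Require Import measurable_realfun.
From mathcomp Require Import ring lra.

Set Implicit Arguments.
Unset Strict Implicit.
Unset Printing Implicit Defensive.

Import Order.TTheory GRing.Theory Num.Theory.
Import numFieldNormedType.Exports.

Local Open Scope classical_set_scope.
Local Open Scope ring_scope.

(** * Products of sigma-finite measures *)

Section product_sigma_finite.
Context d1 d2 (T1 : measurableType d1) (T2 : measurableType d2) (R : realType).
Variables (m1 : {sigma_finite_measure set T1 -> \bar R})
  (m2 : {sigma_finite_measure set T2 -> \bar R}).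

Lemma sigma_finite_product_measure1 : sigma_finite setT (m1 \x m2)%E.
Proof.
have /sigma_finiteP[F [TF ndF Foo]] := sigma_finiteT m1.
have /sigma_finiteP[G [TG ndG Goo]] := sigma_finiteT m2.
exists (fun n => F n `*` G n) => [|n].
  apply/esym/seteqP; split => // -[x y] _.
  have [i _ Fix] : (\bigcup_i F i) x by rewrite -TF.
  have [j _ Gjy] : (\bigcup_j G j) y by rewrite -TG.
  exists (maxn i j) => //; split.
    by move/subsetPset: (ndF _ _ (leq_maxl i j)); exact.
  by move/subsetPset: (ndG _ _ (leq_maxr i j)); exact.
have [mF Fn] := Foo n; have [mG Gn] := Goo n.
split; first exact: measurableX.
by rewrite product_measure1E// lte_mul_pinfty// ge0_fin_numE.
Qed.

(* The instance that the library declares for [m1 \x m2] is masked by the one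
   for products of subprobabilities. *)
Definition sigma_finite_product : {sigma_finite_measure set (T1 * T2)%type -> \bar R} :=
  HB.pack (m1 \x m2)%E
    (Measure_isSigmaFinite.Build _ _ _ (m1 \x m2)%E sigma_finite_product_measure1).

End product_sigma_finite.

(** * Functions of class C1 on a segment *)

Section C1_pairs.
Context {R : realType}.
Local Notation mu := (@lebesgue_measure R).
Implicit Types (a b : R) (F G : R -> R).

(** The derivative is a second function, continuous up to the endpoints but tied to [F] only inside:
    products, inverses and compositions then involve no one-sided derivative, and the fundamental
    theorem of calculus still applies. *)
Definition C1_pair a b F F' : Prop :=
  [/\ {within `[a, b], continuous F}, {within `[a, b], continuous F'} &
      forall t, t \in `]a, b[ -> is_derive t (1 : R) F (F' t)].

Lemma within_continuousM a b F G :
  {within `[a, b], continuous F} -> {within `[a, b], continuous G} ->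
  {within `[a, b], continuous (fun t => F t * G t)}.
Proof. by move=> cF cG x; apply: cvgM; [exact: cF|exact: cG]. Qed.

Lemma within_continuousD a b F G :
  {within `[a, b], continuous F} -> {within `[a, b], continuous G} ->
  {within `[a, b], continuous (fun t => F t + G t)}.
Proof. by move=> cF cG x; apply: cvgD; [exact: cF|exact: cG]. Qed.

Lemma within_continuousN a b F : {within `[a, b], continuous F} ->
  {within `[a, b], continuous (fun t => - F t)}.
Proof. by move=> cF x; apply: cvgN; exact: cF. Qed.

Lemma within_continuousV a b F :
  (forall t, a <= t <= b -> F t != 0) ->
  {within `[a, b], continuous F} ->
  {within `[a, b], continuous (fun t => (F t)^-1)}.
Proof.
move=> F0 /subspace_continuousP cF; apply/subspace_continuousP => x xab.
by apply: cvgV; [apply: F0; move: xab; rewrite /= in_itv|exact: cF].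
Qed.

Lemma within_continuous_comp a b F G :
  (forall t, a <= t <= b -> {for F t, continuous G}) ->
  {within `[a, b], continuous F} ->
  {within `[a, b], continuous (fun t => G (F t))}.
Proof.
move=> cG /subspace_continuousP cF; apply/subspace_continuousP => x xab.
apply: (@cvg_comp _ _ _ F G _ (nbhs (F x))); first exact: cF.
by apply: cG; move: xab; rewrite /= in_itv.
Qed.

Lemma continuous_within_pt a b G :
  (forall t, a <= t <= b -> {for t, continuous G}) ->
  {within `[a, b], continuous G}.
Proof.
move=> cG; apply/subspace_continuousP => x xab; apply: cvg_within_filter.
by apply: cG; move: xab; rewrite /= in_itv.
Qed.

Lemma continuous_within_integrable a b F :
  {within `[a, b], continuous F} -> mu.-integrable `[a, b] (EFin \o F).
Proof. by apply: continuous_compact_integrable; exact: segment_compact. Qed.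

Lemma C1_pairM a b F F' G G' : C1_pair a b F F' -> C1_pair a b G G' ->
  C1_pair a b (fun t => F t * G t) (fun t => F' t * G t + F t * G' t).
Proof.
move=> [cF cF' dF] [cG cG' dG]; split.
- exact: within_continuousM.
- by apply: within_continuousD; exact: within_continuousM.
- move=> t tab; have := is_deriveM (dF _ tab) (dG _ tab).
  by rewrite addrC /GRing.scale /= [G t * _]mulrC.
Qed.

Lemma C1_pairV a b F F' : (forall t, a <= t <= b -> F t != 0) ->
  C1_pair a b F F' ->
  C1_pair a b (fun t => (F t)^-1) (fun t => - ((F t)^-1 * (F t)^-1) * F' t).
Proof.
move=> F0 [cF cF' dF]; split.
- exact: within_continuousV.
- apply: within_continuousM => //; apply: within_continuousN.
  by apply: within_continuousM; exact: within_continuousV.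
- move=> t tab; have Ft0 : F t != 0.
    by apply: F0; move: tab; rewrite in_itv /= => /andP[/ltW -> /ltW ->].
  by have := is_deriveV Ft0 (dF _ tab); rewrite expr2 invfM.
Qed.

Lemma C1_pair_comp a b F F' G G' : C1_pair a b F F' ->
  (forall t, a <= t <= b -> {for F t, continuous G}) ->
  (forall t, a <= t <= b -> {for F t, continuous G'}) ->
  (forall t, t \in `]a, b[ -> is_derive (F t) (1 : R) G (G' (F t))) ->
  C1_pair a b (fun t => G (F t)) (fun t => G' (F t) * F' t).
Proof.
move=> [cF cF' dF] cG cG' dG; split.
- exact: within_continuous_comp.
- by apply: within_continuousM => //; exact: within_continuous_comp.
- by move=> t tab; exact: (is_derive1_comp (dG _ tab) (dF _ tab)).
Qed.

Lemma C1_pair_FTC a b F F' : a < b -> C1_pair a b F F' ->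
  \int[mu]_(t in `[a, b]) F' t = F b - F a.
Proof.
move=> ab [cF cF' dF]; rewrite /Rintegral (@continuous_FTC2 _ F' F)//.
  have /continuous_within_itvP := cF; move=> /(_ ab)[_ Fa Fb]; split => //.
  by move=> t /dF[].
by move=> t /dF[dFt <-]; rewrite derive1E.
Qed.

Lemma C1_pair_cst a b (c : R) : C1_pair a b (fun=> c) (fun=> 0).
Proof.
by split; [exact: cst_continuous|exact: cst_continuous|by move=> t _; exact: is_derive_cst].
Qed.

Lemma C1_pair_id a b : C1_pair a b id (fun=> 1).
Proof.
split; [|exact: cst_continuous|by move=> t _; exact: is_derive_id].
by apply: continuous_subspaceT => x; exact: cvg_id.
Qed.

Lemma within_continuous_bounded a b F : a <= b ->
  {within `[a, b], continuous F} ->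
  exists2 L, 0 <= L & forall t, a <= t <= b -> `|F t| <= L.
Proof.
move=> ab cF; have cnF : {within `[a, b], continuous (fun t => `|F t|)}.
  by apply: within_continuous_comp => // t _; exact: norm_continuous.
by have [c _ maxF] := EVT_max ab cnF; exists `|F c|.
Qed.

End C1_pairs.

(** * The Volterra equation *)

Section volterra.
Context {R : realType}.
Local Notation mu := (@lebesgue_measure R).
Variables (Em EM c1 c2 a b d e s : R) (q q' H H' A : R -> R).
Hypotheses (ab : a < b) (Em0 : 0 < Em) (EmEM : Em < EM) (c20 : 0 < c2).
Hypothesis c1E : c1 = c2 * Em / EM.
(* [s] is the sign of [q'], and [d] the endpoint at which [q] is maximal. *)
Hypothesis s_de : [/\ s = 1, d = b & e = a] \/ [/\ s = - 1, d = a & e = b].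
Hypotheses (qd : q d = c2) (qe : q e = c1).
Hypothesis q_bnd : forall t, a <= t <= b -> 0 < q t <= c2.
Hypothesis q'_gt0 : forall t, a <= t <= b -> 0 < s * q' t.
Hypotheses (C1q : C1_pair a b q q') (cA : forall v : R, 0 < v -> {for v, continuous A}).
Hypothesis C1H : C1_pair a b H H'.
Hypothesis Hd : H d != 0.
Hypothesis A0 : forall v, v <= Em -> A v = 0.
Hypothesis HA : forall Y : R, 0 < Y -> Y <= EM / c2 ->
  \int[mu]_(t in `[a, b]) (H t * q' t * A (Y * q t)) = 0.

Let Psi (v : R) : R := \int[mu]_(u in `[0, v]) A u.

Let EM0 : 0 < EM. Proof. exact: lt_trans EmEM. Qed.

(** Lets the increasing and the decreasing case share the computations below. *)
Let boundary (F : R -> R) : F b - F a = s * (F d - F e).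
Proof. by case: s_de => -[-> -> ->]; rewrite ?mul1r// mulN1r opprB. Qed.

Let cA_within (v : R) : {within `[0, v], continuous A}.
Proof.
apply: continuous_subspaceT => x.
have [x0|x0] := ltP 0 x; first exact: cA.
(* As [Em] is positive, [A] is zero near every [x <= 0]. *)
apply: (@near_cst_continuous _ _ 0); near=> y; apply: A0.
apply: ltW; near: y; apply: lt_nbhsl; exact: le_lt_trans Em0.
Unshelve. all: by end_near. Qed.

Let Psi_derive (v : R) : 0 < v -> is_derive v (1 : R) Psi (A v).
Proof.
move=> v0; have vv1 : v < v + 1 by rewrite ltrDl.
have [dP PE] := continuous_FTC1_closed vv1
  (continuous_within_integrable (@cA_within (v + 1))) v0 (cA v0).
by apply: DeriveDef; [exact: dP|rewrite -derive1E; exact: PE].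
Qed.

Let Psi_cont (v : R) : 0 < v -> {for v, continuous Psi}.
Proof.
move=> v0; have [dP _] := Psi_derive v0.
by apply: differentiable_continuous; apply/derivable1_diffP.
Qed.

Let Psi0 (v : R) : v <= Em -> Psi v = 0.
Proof.
move=> vEm; rewrite /Psi (@eq_Rintegral _ _ _ _ _ (cst 0)).
  by rewrite Rintegral_cst// mul0r.
by move=> u; rewrite inE /= in_itv /= => /andP[_ uv]; rewrite A0//; exact: le_trans vEm.
Qed.

Let q_gt0 t : a <= t <= b -> 0 < q t.
Proof. by move=> /q_bnd/andP[]. Qed.

(** The derivative of [H t * Psi (Y * q t)] is integrated. Its term in [A] contributes nothing by
    [HA], and the boundary term at [e] vanishes because [Y * c1 <= Em]. *)
Let ibp (Y : R) : 0 < Y -> Y <= EM / c2 ->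
  \int[mu]_(t in `[a, b]) (H' t * Psi (Y * q t)) = s * (H d * Psi (Y * c2)).
Proof.
move=> Y0 YEM; have Yq t : a <= t <= b -> 0 < Y * q t.
  by move=> tab; rewrite mulr_gt0// q_gt0.
have C1Yq : C1_pair a b (fun t => Y * q t) (fun t => Y * q' t).
  have := C1_pairM (C1_pair_cst a b Y) C1q.
  by under [X in C1_pair a b _ X]eq_fun do rewrite mul0r add0r.
have C1P : C1_pair a b (fun t => Psi (Y * q t)) (fun t => A (Y * q t) * (Y * q' t)).
  apply: C1_pair_comp => //.
  - by move=> t tab; apply: Psi_cont; exact: Yq.
  - by move=> t tab; apply: cA; exact: Yq.
  - move=> t; rewrite in_itv /= => /andP[/ltW at_ /ltW tb]; apply: Psi_derive.
    by apply: Yq; rewrite at_.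
have C1HP := C1_pairM C1H C1P.
have := C1_pair_FTC ab C1HP; rewrite (boundary (fun t => H t * Psi (Y * q t))) qe.
rewrite [Psi (Y * c1)]Psi0 ?mulr0 ?subr0 ?qd; last first.
  rewrite c1E mulrA (le_trans (_ : _ <= EM / c2 * (c2 * Em) / EM))//.
    by rewrite ler_wpM2r ?invr_ge0 ?(ltW EM0)// ler_wpM2r// mulr_ge0// ltW.
  rewrite le_eqVlt; apply/orP; left; apply/eqP.
  by field; rewrite (gt_eqF c20) (gt_eqF EM0).
move=> <-; have [cH cH' _] := C1H; have [cP cP' _] := C1P.
rewrite RintegralD//; last 2 first.
- by apply: continuous_within_integrable; exact: within_continuousM.
- by apply: continuous_within_integrable; exact: within_continuousM.
rewrite [X in _ = _ + X](_ : _ = Y * \int[mu]_(t in `[a, b]) (H t * q' t * A (Y * q t))).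
  by rewrite HA// mulr0 addr0.
have [cYq _ _] := C1Yq; have [_ cq' _] := C1q.
rewrite -RintegralZl//; last first.
  apply: continuous_within_integrable; apply: within_continuousM.
    exact: within_continuousM.
  by apply: within_continuous_comp => // t tab; apply: cA; exact: Yq.
by apply: eq_Rintegral => t _; ring.
Qed.

(** The integral equals (c2^(N+1) - c1^(N+1)) / (N+1). The denominator is the gain that [Psi_EM]
    exploits. *)
Let int_qN N : \int[mu]_(t in `[a, b]) (s * q' t * q t ^+ N) <= c2 ^+ N.+1 / N.+1%:R.
Proof.
have C1G : C1_pair a b (fun t => N.+1%:R^-1 * q t ^+ N.+1) (fun t => q' t * q t ^+ N).
  have := @C1_pair_comp _ a b q q' (fun x => N.+1%:R^-1 * x ^+ N.+1) (fun x => x ^+ N) C1q.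
  under [X in _ -> _ -> _ -> C1_pair a b _ X]eq_fun do rewrite mulrC.
  apply=> t tab.
  - by apply: cvgM; [exact: cvg_cst|exact: exprn_continuous].
  - exact: exprn_continuous.
  - have dX : is_derive (q t) (1 : R) (fun x => x ^+ N.+1) (N.+1%:R * q t ^+ N).
      by apply: DeriveDef; [exact: exprn_derivable|rewrite exp_derive /GRing.scale /= mulr1].
    have := is_deriveZ N.+1%:R^-1 dX.
    by rewrite /GRing.scale /= mulKf// pnatr_eq0.
have [cq cq' _] := C1q; have [_ cG' _] := C1G.
under eq_Rintegral do rewrite -mulrA.
rewrite RintegralZl//; last exact: continuous_within_integrable.
rewrite (C1_pair_FTC ab C1G) (boundary (fun t => N.+1%:R^-1 * q t ^+ N.+1)).
rewrite mulrA (_ : s * s = 1) ?mul1r; last first.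
  by case: s_de => -[-> _ _]; rewrite ?mulrNN mulr1.
rewrite qd qe [leRHS]mulrC -mulrBr ler_wpM2l ?invr_ge0//.
rewrite gerBl exprn_ge0// c1E; apply/ltW; rewrite divr_gt0// mulr_gt0//.
Qed.

(** Let M be the maximum of |Psi(u)| / u^N on [Em, EM], attained at v0. Inserting |Psi(u)| <= M u^N
    into [ibp] with Y c2 = v0 yields |H(d)| M <= (L c2 / (N+1)) M, which forces M = 0 for N
    large. *)
Let Psi_EM (v : R) : v <= EM -> Psi v = 0.
Proof.
move=> vEM; have [cq cq' _] := C1q; have [cH cH' _] := C1H.
have sq'0 t : a <= t <= b -> s * q' t != 0 by move=> /q'_gt0/gt_eqF ->.
have csq' : {within `[a, b], continuous (fun t => s * q' t)}.
  by apply: within_continuousM => //; exact: cst_continuous.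
(* Bounding [H'] by a multiple of [s * q'] brings in the integrand of [int_qN]. *)
have [L L0 HL] : exists2 L, 0 <= L & forall t, a <= t <= b -> `|H' t| <= L * (s * q' t).
  have [L L0 HL] := within_continuous_bounded (ltW ab)
    (within_continuousM cH' (within_continuousV sq'0 csq')).
  exists L => // t tab; have := HL _ tab.
  by rewrite normrM normfV (gtr0_norm (q'_gt0 tab)) ler_pdivrMr// q'_gt0.
(* Large enough for the constant L c2 / (N+1) of the final estimate to be below |H(d)|. *)
pose N := Num.bound (L * c2 / `|H d|).
have HN : L * c2 / N.+1%:R < `|H d|.
  rewrite ltr_pdivrMr// [ltRHS]mulrC -ltr_pdivrMr ?normr_gt0//.
  have bnd0 : 0 <= L * c2 / `|H d| by rewrite divr_ge0// mulr_ge0// ltW.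
  by rewrite (lt_le_trans (archi_boundP bnd0))// ler_nat.
have vN0 u : Em <= u <= EM -> u ^+ N != 0.
  by move=> /andP[Emu _]; rewrite expf_neq0// gt_eqF// (lt_le_trans Em0).
(* The quotient is studied on [Em, EM], away from 0; below [Em], [Psi] vanishes anyway. *)
have cPN : {within `[Em, EM], continuous (fun u => `|Psi u| * (u ^+ N)^-1)}.
  apply: within_continuousM.
    apply: within_continuous_comp => [t _|]; first exact: norm_continuous.
    apply: continuous_within_pt => t /andP[Emt _].
    by apply: Psi_cont; exact: lt_le_trans Emt.
  apply: within_continuousV => //; apply: continuous_within_pt => t _.
  exact: exprn_continuous.
have [v0 v0E maxP] := EVT_max (ltW EmEM) cPN.
have {}v0E : Em <= v0 <= EM by move: v0E; rewrite in_itv.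
have v00 : 0 < v0 by case/andP: v0E => /(lt_le_trans Em0).
pose M := `|Psi v0| * (v0 ^+ N)^-1.
have M0 : 0 <= M by rewrite mulr_ge0// invr_ge0 exprn_ge0// ltW.
have PsiM u : 0 < u -> u <= EM -> `|Psi u| <= M * u ^+ N.
  move=> u0 uEM; have [uEm|Emu] := leP u Em.
    by rewrite Psi0// normr0 mulr_ge0// exprn_ge0// ltW.
  by rewrite -ler_pdivrMr ?exprn_gt0//; apply: maxP; rewrite in_itv /= (ltW Emu).
suff M00 : M = 0.
  have [v_le0|v_gt0] := leP v 0; first by rewrite Psi0// (le_trans v_le0)// ltW.
  by apply/eqP; rewrite -normr_le0 (le_trans (PsiM _ v_gt0 vEM))// M00 mul0r.
(* The boundary value in [ibp] is then [Psi v0], and [Y * q t] never exceeds [v0]. *)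
pose Y := v0 / c2.
have Y0 : 0 < Y by rewrite divr_gt0.
have Yc2 : Y * c2 = v0 by rewrite /Y mulfVK// gt_eqF.
have YEM : Y <= EM / c2 by rewrite ler_wpM2r ?invr_ge0 ?(ltW c20)//; case/andP: v0E.
have cPq : {within `[a, b], continuous (fun t => Psi (Y * q t))}.
  apply: (within_continuous_comp (F := fun t => Y * q t)).
    by move=> t tab; apply: Psi_cont; rewrite mulr_gt0// q_gt0.
  by apply: within_continuousM => //; exact: cst_continuous.
have cqN : {within `[a, b], continuous (fun t => s * q' t * q t ^+ N)}.
  apply: within_continuousM => //.
  apply: (within_continuous_comp (G := fun x => x ^+ N) _ cq) => t _.
  exact: exprn_continuous.
have key : `|H d| * `|Psi v0| <= L * M * Y ^+ N * (c2 ^+ N.+1 / N.+1%:R).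
  have -> : `|H d| * `|Psi v0| = `|\int[mu]_(t in `[a, b]) (H' t * Psi (Y * q t))|.
    rewrite ibp// Yc2 !normrM (_ : `|s| = 1) ?mul1r//.
    by case: s_de => -[-> _ _]; rewrite ?normrN normr1.
  have iHP := continuous_within_integrable (within_continuousM cH' cPq).
  apply: (le_trans (le_normr_Rintegral _ iHP)) => //.
  apply: (@le_trans _ _ (\int[mu]_(t in `[a, b]) (L * M * Y ^+ N * (s * q' t * q t ^+ N)))).
    apply: le_Rintegral => //.
    - apply: (continuous_within_integrable (F := fun t => `|H' t * Psi (Y * q t)|)).
      apply: (within_continuous_comp _ (within_continuousM cH' cPq)) => t _.
      exact: norm_continuous.
    - apply: (continuous_within_integrable (F := fun t => L * M * Y ^+ N * (s * q' t * q t ^+ N))).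
      by apply: within_continuousM => //; exact: cst_continuous.
    - move=> t; rewrite /= in_itv /= => tab; rewrite normrM.
      have /andP[qt0 qtc2] := q_bnd tab.
      rewrite [leRHS](_ : _ = (L * (s * q' t)) * (M * (Y * q t) ^+ N)); last first.
        by rewrite (exprMn N Y (q t)); ring.
      apply: ler_pM => //; first exact: HL.
      apply: PsiM; first by rewrite mulr_gt0.
      rewrite (@le_trans _ _ v0)//; last by case/andP: v0E.
      by rewrite -Yc2 ler_wpM2l// ltW.
  rewrite RintegralZl//; last exact: continuous_within_integrable.
  by apply: ler_wpM2l; [apply: mulr_ge0; [exact: mulr_ge0|exact/exprn_ge0/ltW]|exact: int_qN].
have PM : `|Psi v0| = M * v0 ^+ N by rewrite /M mulfVK// vN0.
move: key; rewrite PM -Yc2 (exprMn N Y c2) exprS.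
rewrite [leLHS](_ : _ = `|H d| * M * (Y ^+ N * c2 ^+ N)); last by ring.
rewrite [leRHS](_ : _ = L * c2 / N.+1%:R * M * (Y ^+ N * c2 ^+ N)); last by ring.
rewrite ler_pM2r ?mulr_gt0 ?exprn_gt0// => key.
apply/eqP; rewrite eq_le M0 andbT leNgt; apply/negP => M_gt0.
by move: key; rewrite ler_pM2r// leNgt HN.
Qed.

(** [Psi] vanishes in a neighbourhood of [v], hence so does its derivative [A] at [v] when [v] is
    positive. *)
Lemma volterra_inj (v : R) : v < EM -> A v = 0.
Proof.
move=> vEM; have [v0|v0] := leP v 0; first by rewrite A0// (le_trans v0)// ltW.
have [_ <-] := Psi_derive v0.
rewrite -derive1E -(derive1_cst 0 v); rewrite !derive1E; apply: near_eq_derive.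
near=> u; apply: Psi_EM; apply: ltW; near: u; exact: lt_nbhsl.
Unshelve. all: by end_near. Qed.

End volterra.

(** * Affine changes of variables *)

Section affine_change_of_variables.
Context {R : realType}.
Local Notation mu := (@lebesgue_measure R).
Local Notation m := (mu \x mu)%E.
Local Open Scope ereal_scope.

Let affine (c d : R) : measurableTypeR R -> measurableTypeR R :=
  fun x => (c * x + d)%R.

Let measurable_affine c d : measurable_fun setT (affine c d).
Proof.
apply: measurable_funD => //; apply: measurable_funM => //.
Qed.

(** By uniqueness of Lebesgue measure: [c] times the push-forward of [mu] under the affine map gives
    half-open intervals their length. *)
Lemma ge0_integral_affine (c d : R) (F : R -> \bar R) : (0 < c)%R ->
  measurable_fun setT F -> (forall x, 0 <= F x) ->
  \int[mu]_x F (c * x + d)%R = c^-1%:E * \int[mu]_x F x.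
Proof.
move=> c0 mF F0.
pose nu_ := mscale (NngNum (ltW c0)) (pushforward mu (affine c d)).
pose nu := nu_ (measurable_affine c d).
have muE : forall A, measurable A -> mu A = nu A.
  apply: lebesgue_measure_unique => _ [[x y] _ <-].
  rewrite /= /nu /nu_ /mscale /= /pushforward.
  rewrite (_ : affine c d @^-1` _ = `](x - d) / c, (y - d) / c]%classic)%R; last first.
    apply/seteqP; split => z; rewrite /= !in_itv /= ltr_pdivrMr// ler_pdivlMr//;
    by rewrite ltrBlDr lerBrDr /affine [(c * z)%R]mulrC.
  rewrite !lebesgue_measure_itv /= !lte_fin.
  rewrite ltr_pM2r ?invr_gt0// ltrD2r; case: ifPn => _; last by rewrite mule0.
  rewrite -!EFinB -EFinM; congr EFin.
  by field; rewrite gt_eqF.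
rewrite [X in _ * X](eq_measure_integral nu); last by move=> A mA _; exact: muE.
rewrite ge0_integral_mscale// muleA -EFinM mulVf ?gt_eqF// mul1e.
by rewrite ge0_integral_pushforward.
Qed.

Lemma integral_translation (d : R) (F : R -> \bar R) : measurable_fun setT F ->
  \int[mu]_x F (x + d)%R = \int[mu]_x F x.
Proof.
have ge0 G : measurable_fun setT G -> (forall x, 0 <= G x) ->
    \int[mu]_x G (x + d)%R = \int[mu]_x G x.
  move=> mG G0; have := ge0_integral_affine d ltr01 mG G0.
  by rewrite invr1 mul1e; under eq_integral do rewrite mul1r.
move=> mF; rewrite integralE [RHS]integralE.
rewrite -(ge0 F^\+)//; last exact: measurable_funepos.
rewrite -(ge0 F^\-)//; last exact: measurable_funeneg.
by congr (_ - _); apply: eq_integral => x _; rewrite ?funeposE ?funenegE.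
Qed.

Lemma integral_reflection (F : R -> \bar R) : measurable_fun setT F ->
  \int[mu]_x F (- x)%R = \int[mu]_x F x.
Proof.
have ge0 G : measurable_fun setT G -> (forall x, 0 <= G x) ->
    \int[mu]_x G (- x)%R = \int[mu]_x G x.
  move=> mG G0; rewrite [RHS](eq_measure_integral
    (pushforward mu (-%R : _ -> measurableTypeR R))).
    by rewrite ge0_integral_pushforward.
  by move=> A mA _; exact/esym/lebesgue_measureN.
move=> mF; rewrite integralE [RHS]integralE.
rewrite -(ge0 F^\+)//; last exact: measurable_funepos.
rewrite -(ge0 F^\-)//; last exact: measurable_funeneg.
by congr (_ - _); apply: eq_integral => x _; rewrite ?funeposE ?funenegE.
Qed.

(** Tonelli's theorem treats one variable at a time; only the scaling of the first contributes a
    Jacobian. *)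
Lemma ge0_integral_scale_translation (c t : R) (F : R * R -> \bar R) :
  (0 < c)%R -> measurable_fun setT F -> (forall z, 0 <= F z) ->
  \int[m]_z F (z.1 * c, z.2 + t)%R = c^-1%:E * \int[m]_z F z.
Proof.
move=> c0 mF F0; pose T := fun z : measurableTypeR R * measurableTypeR R => (z.1 * c, z.2 + t)%R.
have mT : measurable_fun setT T.
  by apply/measurable_fun_pairP; split; [apply: measurable_funM|apply: measurable_funD].
rewrite !fubini_tonelli1//; last exact: (measurableT_comp mF mT).
rewrite /fubini_F /=.
under eq_integral => E _.
  rewrite (integral_translation t (F := fun s => F ((E * c)%R, s))); last first.
    exact: measurableT_comp.
  over.
rewrite -(ge0_integral_affine 0%R (F := fun E => \int[mu]_s F (E, s)) c0).
- by apply: eq_integral => E _; rewrite addr0 [(E * c)%R]mulrC.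
- exact: measurable_fun_fubini_tonelli_F.
- by move=> x; exact: integral_ge0.
Qed.

Lemma integral_scale_translation (c t : R) (F : R * R -> \bar R) :
  (0 < c)%R -> m.-integrable setT F ->
  \int[m]_z F (z.1 * c, z.2 + t)%R = c^-1%:E * \int[m]_z F z.
Proof.
move=> c0 /[dup] iF /integrableP[mF _].
rewrite integralE [in RHS]integralE muleBr//; last first.
  by rewrite fin_num_adde_defr//; apply: integrable_pos_fin_num.
rewrite -(ge0_integral_scale_translation t c0 (F := F^\+))//; last exact: measurable_funepos.
rewrite -(ge0_integral_scale_translation t c0 (F := F^\-))//; last exact: measurable_funeneg.
by congr (_ - _); apply: eq_integral => x _; rewrite ?funeposE ?funenegE.
Qed.

End affine_change_of_variables.

(** * Exponential moments on the line *)

Section vanishing_moments.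
Context {R : realType}.
Local Notation mu := (@lebesgue_measure R).
Implicit Types F : R -> R.

(** By Lebesgue differentiation, [F] is almost everywhere the derivative of its primitive, which is
    zero on the open set [U]. *)
Lemma ae_eq0_primitive F (U : set R) :
  open U -> mu.-integrable setT (EFin \o F) ->
  (forall v, U v -> \int[mu]_(x in `]-oo, v]) F x = 0) ->
  {ae mu, forall v, U v -> F v = 0}.
Proof.
move=> oU iF F0.
have locF : locally_integrable setT F.
  by have := integrable_locally measurableT iF; rewrite patch_setT.
have iFy (y : R) : mu.-integrable `]-oo, y] (EFin \o F).
  by apply: (integrableS measurableT).
have := FTC1Ny iFy locF.
apply: filterS; first exact: (ae_filter_ringOfSetsType mu).
move=> v [_ <-] Uv.
rewrite -(derive1_cst (0 : R) v) !derive1E; apply: near_eq_derive.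
by have := open_nbhs_nbhs (conj oU Uv); apply: filterS => u Uu; exact: F0.
Qed.

(** Dominated convergence with dominating function C |F|. The [g_ n] are bounded only where [F] is
    nonzero, which admits exponentials. *)
Lemma integral_limit_eq0 F (g_ : nat -> R -> R) (g : R -> R) (C : R) :
  mu.-integrable setT (EFin \o F) ->
  (forall n, measurable_fun setT (g_ n)) -> measurable_fun setT g ->
  (forall n x, F x != 0 -> `|g_ n x| <= C) ->
  {ae mu, forall x, g_ n x @[n --> \oo] --> g x} ->
  (forall n, \int[mu]_x (F x * g_ n x)%:E = 0)%E ->
  (\int[mu]_x (F x * g x)%:E = 0)%E.
Proof.
move=> iF mg_ mg bg cg F0.
have mF : measurable_fun setT F by apply/measurable_EFinP; case/integrableP: iF.
have mFg_ n : measurable_fun setT (fun x => (F x * g_ n x)%:E).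
  by apply/measurable_EFinP; exact: measurable_funM.
have mFg : measurable_fun setT (fun x => (F x * g x)%:E).
  by apply/measurable_EFinP; exact: measurable_funM.
have Fg_cvg : {ae mu, forall x, setT x ->
    (F x * g_ n x)%:E @[n --> \oo] --> (F x * g x)%:E}.
  apply: filterS cg; first exact: (ae_filter_ringOfSetsType mu).
  move=> x cgx _; apply: cvg_EFin; first exact: nearW.
  by apply: cvgM => //; exact: cvg_cst.
have iCF : mu.-integrable setT (fun x => C%:E * `|(F x)%:E|)%E.
  by apply: integrableZl => //; exact: integrable_abse.
have FgC : {ae mu, forall x n, setT x -> (`|(F x * g_ n x)%:E| <= C%:E * `|(F x)%:E|)%E}.
  apply: aeW => x n _; rewrite /= normrM -EFinM lee_fin mulrC.
  have [->|Fx0] := eqVneq (F x) 0; first by rewrite normr0 !mulr0.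
  by rewrite ler_wpM2r// bg.
have [_ _] := @dominated_convergence _ (measurableTypeR R) R mu setT measurableT
  _ _ _ mFg_ mFg Fg_cvg iCF FgC.
under [X in X @ _]eq_fun do rewrite F0.
by move=> /cvg_lim; rewrite lim_cst// => ->.
Qed.

Variables (F : R -> R) (B : R).
Hypotheses (iF : mu.-integrable setT (EFin \o F)).
Hypothesis F_supp : forall x, B < `|x| -> F x = 0.
Hypothesis mom : forall n : nat, (\int[mu]_x (F x * expR (n%:R * x))%:E = 0)%E.

Let F_supp_le x : F x != 0 -> x <= B.
Proof.
move=> Fx; rewrite leNgt; apply/negP => Bx; move/eqP: Fx; apply.
by apply: F_supp; rewrite (lt_le_trans Bx)// ler_norm.
Qed.

Let mF : measurable_fun setT F.
Proof. by apply/measurable_EFinP; case/integrableP: iF. Qed.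

Let mexp (n : nat) : measurable_fun setT (fun x : R => expR (n%:R * x)).
Proof. exact: measurableT_comp. Qed.

Let iFexp (n : nat) : mu.-integrable setT (fun x => (F x * expR (n%:R * x))%:E).
Proof.
apply: (@le_integrable _ _ _ mu setT _ _ (fun x => (expR (n%:R * B))%:E * (F x)%:E)%E) => //.
- by apply/measurable_EFinP; apply: measurable_funM; [exact: mF|exact: mexp].
- move=> x _; rewrite /= lee_fin normrM mulrC [leRHS]normrM.
  have [->|/F_supp_le xB] := eqVneq (F x) 0; first by rewrite normr0 !mulr0.
  by rewrite ler_wpM2r// !ger0_norm ?expR_ge0// ler_expR ler_wpM2l.
- exact: integrableZl.
Qed.

(* [exp (- ekx k a x)] is the pointwise limit of the [psum k a N x], linear
   combinations of the [exp (k j x)], and tends to the indicator of ]-oo, a[ in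
   turn as [k] grows. *)
Let ekx (k : nat) (a x : R) := expR (k%:R * (x - a)).

Let mekx k a : measurable_fun setT (ekx k a).
Proof. by apply: measurableT_comp => //; apply: measurable_funM => //; exact: measurable_funB. Qed.

Let psum (k : nat) (a : R) (N : nat) (x : R) := series (exp_coeff (- ekx k a x)) N.

Let mpsum k a N : measurable_fun setT (psum k a N).
Proof.
rewrite /psum /series /=; apply: measurable_sum => j; rewrite /exp_coeff /=.
by apply: measurable_funM => //; apply: measurable_funX; exact: measurableT_comp.
Qed.

Let psum_mom k a N : mu.-integrable setT (fun x => (F x * psum k a N x)%:E) /\
  (\int[mu]_x (F x * psum k a N x)%:E = 0)%E.
Proof.
elim: N => [|N [ipsum psum0]].
  under [X in _.-integrable _ X /\ _]eq_fun do rewrite /psum /series /= big_geq// mulr0.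
  under eq_integral do rewrite /psum /series /= big_geq// mulr0.
  by split; [exact: integrable0|rewrite integral0].
(* The [N]-th term of the exponential series at [- ekx k a x] is a constant times e^(N k x), whose
   moment is zero by [mom] at [N * k]. *)
have E x : (F x * psum k a N.+1 x)%:E = ((F x * psum k a N x)%:E +
    (((- 1) ^+ N * expR (- ((N * k)%:R * a)) / N`!%:R)%:E * (F x * expR ((N * k)%:R * x))%:E))%E.
  rewrite -EFinM -EFinD /psum /series /= big_nat_recr//= mulrDr; congr (_ + _)%:E.
  rewrite /exp_coeff /= /ekx [in LHS]exprNn -expRM_natl -[in RHS]mulrA.
  rewrite (_ : N%:R * (k%:R * (x - a)) = - ((N * k)%:R * a) + (N * k)%:R * x).
    by rewrite expRD; ring.
  by rewrite natrM; ring.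
have iZ : mu.-integrable setT (fun x =>
    (((- 1) ^+ N * expR (- ((N * k)%:R * a)) / N`!%:R)%:E * (F x * expR ((N * k)%:R * x))%:E)%E).
  by apply: integrableZl => //; exact: iFexp.
under [X in _.-integrable _ X /\ _]eq_fun do rewrite E.
under eq_integral do rewrite E.
split; first exact: integrableD.
rewrite (integralD measurableT ipsum iZ) psum0 add0e.
by rewrite (integralZl measurableT (iFexp (N * k))) mom mule0.
Qed.

(** Termwise absolute values give a partial sum of the series of exp(ekx k a x), and [ekx k a]
    increases with [x <= B]. The bound is uniform in [N]. *)
Let psum_bnd k a N x : F x != 0 -> `|psum k a N x| <= expR (ekx k a B).
Proof.
move=> /F_supp_le xB; rewrite /psum /series /=.
apply: (le_trans (ler_norm_sum _ _ _)).
apply: (@le_trans _ _ (series (exp_coeff (ekx k a B)) N)).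
  apply: ler_sum => j _; rewrite /exp_coeff /= normrM normrX normrN normfV.
  rewrite [`|j`!%:R|]ger0_norm// ler_wpM2r ?invr_ge0//.
  apply: lerXn2r; rewrite ?nnegrE ?normr_ge0 ?expR_ge0//.
  by rewrite ger0_norm ?expR_ge0// ler_expR ler_wpM2l// lerB.
rewrite /expR; apply: nondecreasing_cvgn_le; last exact: is_cvg_series_exp_coeff.
apply/nondecreasing_seqP => n; rewrite /series /= big_nat_recr//= lerDl.
by rewrite /exp_coeff /= divr_ge0// exprn_ge0// expR_ge0.
Qed.

Let exp_mom k a : (\int[mu]_x (F x * expR (- ekx k a x))%:E = 0)%E.
Proof.
apply: (@integral_limit_eq0 F (psum k a) _ (expR (ekx k a B))) => //.
- by apply: measurableT_comp => //; exact: measurableT_comp.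
- by move=> n x; exact: psum_bnd.
- by apply: aeW => x; exact: is_cvg_series_exp_coeff.
- by move=> n; have [] := psum_mom k a n.
Qed.

Let exp_cvg (a x : R) : x != a ->
  expR (- ekx n a x) @[n --> \oo] --> (\1_(`]-oo, a]) x : R).
Proof.
move=> xa; rewrite /ekx indicE; have [ax|xa'] := ltP a x.
  rewrite memNset; last by rewrite /= in_itv /= leNgt ax.
  (* With y = n (x - a), the inequality e^y >= 1 + y gives exp(- e^y) <= e^(- y) = (e^(a - x))^n. *)
  apply: (@squeeze_cvgr _ _ _ _ (cst 0) (fun n => expR (a - x) ^+ n)).
  - apply: nearW => n; rewrite expR_ge0 /= -expRM_natl ler_expR lerNl.
    rewrite (le_trans _ (expR_ge1Dx _))//.
    by rewrite -mulrN opprB lerDr.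
  - exact: cvg_cst.
  - by apply: cvg_expr; rewrite ger0_norm ?expR_ge0// expR_lt1 subr_lt0.
rewrite mem_set; last by rewrite /= in_itv.
have -> : true%:R = expR (- 0) :> R by rewrite oppr0 expR0.
apply: (cvg_comp (fun n : nat => - expR (n%:R * (x - a))) expR); last exact: continuous_expR.
apply: cvgN; under eq_fun do rewrite expRM_natl.
apply: cvg_expr; rewrite ger0_norm ?expR_ge0// expR_lt1 subr_lt0.
by rewrite lt_neqAle xa.
Qed.

(** As [k] grows, [exp_mom] shows that [F] has integral zero over each ]-oo, v]. Convergence to the
    indicator fails only at [x = v], a null set. *)
Lemma ae_eq0_moments : {ae mu, forall x, F x = 0}.
Proof.
have F0 v : (\int[mu]_x (F x * \1_(`]-oo, v]) x)%:E = 0)%E.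
  apply: (@integral_limit_eq0 F (fun k x => expR (- ekx k v x)) _ 1) => //.
  - by move=> k; apply: measurableT_comp => //; exact: measurableT_comp.
  - by move=> n x _; rewrite ger0_norm ?expR_ge0// expR_le1 oppr_le0 expR_ge0.
  - exists [set v]; split => //; first exact: lebesgue_measure_set1.
    move=> x /= nx; apply: contrapT => /eqP xv; apply: nx; exact: exp_cvg.
have := @ae_eq0_primitive F setT openT iF.
have H v : \int[mu]_(x in `]-oo, v]) F x = 0.
  rewrite Rintegral_mkcond /Rintegral -[RHS](congr1 fine (F0 v)).
  congr fine; apply: eq_integral => x _; rewrite patchE indicE.
  by case: ifPn => _; rewrite ?mulr1 ?mulr0.
move=> /(_ (fun v _ => H v)); apply: filterS; last by move=> v; exact.
exact: (ae_filter_ringOfSetsType mu).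
Qed.

End vanishing_moments.

(** * From the Bragg transform to the Volterra equation *)

Section reduction.
Context {R : realType}.
Local Notation mu := (@lebesgue_measure R).
Local Notation m := (mu \x mu)%E.
Variables (Em EM w K : R) (q W1 W2 : R -> R) (W : R -> R -> R) (f : R * R -> R).
Hypotheses (Em0 : 0 < Em) (w0 : 0 <= w).
Hypothesis WE : forall E t : R, 0 < E -> W E t = W1 E * W2 t.
Hypothesis W1_neq0 : forall E : R, 0 < E -> W1 E != 0.
Hypothesis mq : measurable_fun setT (fun t : measurableTypeR R => q `|t|).
Hypothesis mW2 : measurable_fun setT (fun t : measurableTypeR R => W2 `|t|).
Hypothesis W2K : forall t : R, 0 <= t <= w -> `|W2 t| <= K.
Hypothesis mf : measurable_fun setT (f : measurableTypeR R * measurableTypeR R -> R).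
Hypothesis f0 : forall u s, ~ Em <= u <= EM -> f (u, s) = 0.
Hypothesis f_exp : forall n : nat,
  m.-integrable setT (fun z => (f z * expR (n%:R * z.2))%:E).
Hypothesis Bf0 : {ae m, forall z, 0 < z.1 -> bragg q W w f z = 0}.

(** Being real-valued, it takes the default value 0 where the section integral is infinite, and
    agrees with that integral almost everywhere ([ae_phi]). *)
Definition exp_moment (n : nat) (u : R) : R :=
  \int[mu]_x (f (u, x) * expR (n%:R * x)).

Definition cumulative_moment (n : nat) (v : R) : R :=
  \int[mu]_(u in `]-oo, v]) exp_moment n u.

Local Notation phi := exp_moment.
Local Notation A := cumulative_moment.

Lemma exp_moment_out n u : ~ Em <= u <= EM -> phi n u = 0.
Proof.
move=> uE; rewrite /phi (@eq_Rintegral _ _ _ _ _ (cst 0)).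
  by rewrite Rintegral_cst// mul0r.
by move=> x _; rewrite f0// mul0r.
Qed.

Let ae_phi n : ae_eq mu setT (EFin \o phi n)
  (fun u => \int[mu]_x (f (u, x) * expR (n%:R * x))%:E)%E.
Proof.
have := integrable_ae measurableT (integrable_fubini_F (f_exp n)).
apply: filterS => u /(_ I) fin _.
by rewrite /= /phi /Rintegral fineK.
Qed.

Lemma integrable_exp_moment n : mu.-integrable setT (EFin \o phi n).
Proof.
have /integrableP[mF Fioo] := integrable_fubini_F (f_exp n).
apply/integrableP; split.
  by apply/measurable_EFinP; apply: (measurableT_comp _ mF); exact: fine_measurable.
rewrite (le_lt_trans _ Fioo)// le_eqVlt; apply/orP; left; apply/eqP.
apply: ge0_ae_eq_integral => //.
- apply: measurableT_comp => //.
  by apply/measurable_EFinP; apply: (measurableT_comp _ mF); exact: fine_measurable.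
- exact: measurableT_comp.
- by have := ae_phi n; apply: filterS => u /(_ I) E _; congr abse; exact: E.
Qed.

Let J n (v : R) (z : measurableTypeR R * measurableTypeR R) : R :=
  \1_(`]-oo, v]) z.1 * (f z * expR (n%:R * z.2)).

Let mJ1 (D : interval R) : measurable_fun setT
  (fun z : measurableTypeR R * measurableTypeR R => \1_([set` D]) z.1 : R).
Proof. by apply: measurableT_comp => //; exact: measurable_indic. Qed.

Let integrable_J n v : m.-integrable setT (EFin \o J n v).
Proof.
have /integrableP[mfe _] := f_exp n.
apply: (le_integrable _ _ _ (f_exp n)) => //.
- apply/measurable_EFinP; apply: measurable_funM; first exact: mJ1.
  exact/measurable_EFinP.
- move=> z _; rewrite /= lee_fin /J normrM.
  by rewrite ler_piMl// indicE; case: (_ \in _); rewrite ?normr1 ?normr0.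
Qed.

Let cumulativeE n v : (\int[m]_z (J n v z)%:E)%E = (A n v)%:E.
Proof.
rewrite -(integral12_prod_meas1 (integrable_J n v)) /A /Rintegral fineK; last first.
  by apply: integrable_fin_num => //; exact: integrableS (integrable_exp_moment n).
rewrite [RHS]integral_mkcond; apply: ae_eq_integral => //.
- by have /integrableP[] := integrable_fubini_F (integrable_J n v).
- apply/(measurable_restrictT _ _).1 => //; apply: measurable_funTS.
  by case/integrableP: (integrable_exp_moment n).
have := ae_phi n; apply: filterS => u /(_ I) E _.
rewrite patchE /fubini_F /J /= indicE.
case: ifPn => uv; last by under eq_integral do rewrite mul0r; rewrite integral0.
by rewrite -[RHS]/((EFin \o phi n) u) E; under eq_integral do rewrite mul1r.
Qed.

Lemma cumulative_moment_out n v : v <= Em -> A n v = 0.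
Proof.
(* The moment may be nonzero at [u = Em]; removing the right endpoint, a null set, leaves only
   [u < Em]. *)
move=> vEm; rewrite /A -Rintegral_itv_bndo_bndc; last first.
  by apply: integrableS (integrable_exp_moment n).
rewrite (@eq_Rintegral _ _ _ _ _ (cst 0)).
  by rewrite Rintegral_cst// mul0r.
move=> u; rewrite inE /= in_itv /= => uv; apply: exp_moment_out.
by apply/negP; rewrite negb_and -ltNge (lt_le_trans uv).
Qed.

(** As [exp_moment] vanishes below [Em], the integral may start at 0, and it is continuous in its
    upper bound. *)
Lemma continuous_cumulative_moment n (v : R) : 0 < v -> {for v, continuous (A n)}.
Proof.
move=> v0; have v1 : v < v + 1 by rewrite ltrDl.
have AE u : 0 <= u -> A n u = parameterized_integral mu 0 u (phi n).
  move=> u0; rewrite /parameterized_integral /A.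
  rewrite [LHS]Rintegral_mkcond [RHS]Rintegral_mkcond; apply: eq_Rintegral => t _.
  rewrite !patchE !mem_setE !in_itv /=; have [t0|t0] := leP 0 t => //=.
  by case: ifP => // _; apply: exp_moment_out; apply/negP; rewrite negb_and -ltNge (lt_trans t0).
have /continuous_within_itvP : {within `[0, v + 1], continuous
    (fun u => parameterized_integral mu 0 u (phi n))}.
  apply: parameterized_integral_continuous; first by rewrite addr_ge0// ltW.
  by apply: integrableS (integrable_exp_moment n).
rewrite addr_gt0// => /(_ isT)[+ _ _] => /(_ v).
rewrite in_itv /= v0 v1 => /(_ isT) cP.
rewrite /prop_for /continuous_at AE ?(ltW v0)//.
apply: cvg_trans cP; apply: near_eq_cvg; near=> u; rewrite AE//.
near: u; exact: lt_le_nbhsr.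
Unshelve. all: by end_near. Qed.

(** * The Bragg equation integrated against e^(n s) over 0 < E <= Y *)

Variables (n : nat) (Y : R).
Hypothesis Y0 : 0 < Y.

(** With z = (E, s) and x = s + t, the product [kappa t * slice z t] is the Bragg integrand times
    e^(n s) / W1(E), for 0 < E <= Y. The factor e^(- n t) offsets the e^(n (s + t)) that [slice]
    needs to produce a moment. *)
Let kappa (t : R) : R := \1_(`[-w, w]) t * (expR (- (n%:R * t)) * W2 `|t|).

Let slice (z : measurableTypeR R * measurableTypeR R) (t : R) : R :=
  \1_(`]0, Y]) z.1 * (f (z.1 * q `|t|, z.2 + t) * expR (n%:R * (z.2 + t))).

Let G (p : (measurableTypeR R * measurableTypeR R) * measurableTypeR R) : R :=
  kappa p.2 * slice p.1 p.2.

Let mkappa : measurable_fun setT (kappa : measurableTypeR R -> R).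
Proof.
apply: measurable_funM; first exact: measurable_indic.
apply: measurable_funM => //; apply: measurableT_comp => //.
by apply: measurableT_comp => //; exact: measurable_funM.
Qed.

Let mslice2 : measurable_fun setT
  (fun p : (measurableTypeR R * measurableTypeR R) * measurableTypeR R => slice p.1 p.2).
Proof.
have mE : measurable_fun setT
    (fun p : (measurableTypeR R * measurableTypeR R) * measurableTypeR R => p.1.1).
  by apply: measurableT_comp.
have ms : measurable_fun setT
    (fun p : (measurableTypeR R * measurableTypeR R) * measurableTypeR R => p.1.2 + p.2).
  by apply: measurable_funD => //; apply: measurableT_comp.
apply: measurable_funM.
  by apply: measurableT_comp; [exact: measurable_indic|exact: mE].
apply: measurable_funM.
  apply: (measurableT_comp mf); apply: measurable_fun_pair => //.
  by apply: measurable_funM => //; exact: (measurableT_comp mq).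
by apply: measurableT_comp => //; exact: measurable_funM.
Qed.

Let mslice t : measurable_fun setT (slice ^~ t).
Proof.
have mt : measurable_fun setT
    (fun z : measurableTypeR R * measurableTypeR R => (z, t : measurableTypeR R)).
  exact: measurable_fun_pair.
exact: (measurableT_comp mslice2 mt).
Qed.

Let mG : measurable_fun setT G.
Proof. by apply: measurable_funM => //; exact: measurableT_comp. Qed.

(** With u = E q(|t|), the cut E <= Y becomes u <= Y q(|t|), while E <= 0 gives u <= 0, where [f] is
    zero. *)
Let sliceE t z : 0 < q `|t| ->
  slice z t = J n (Y * q `|t|) (z.1 * q `|t|, z.2 + t).
Proof.
move=> qt0; rewrite /slice /J /= !indicE !mem_setE !in_itv /=.
rewrite ler_pM2r//; have [z0|z0] := ltP 0 z.1 => //=.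
rewrite f0; first by rewrite !mul0r !mulr0.
apply/negP; rewrite negb_and -ltNge (le_lt_trans _ Em0)//.
by rewrite mulr_le0_ge0// ltW.
Qed.

Let slice0 t z : q `|t| <= 0 -> slice z t = 0.
Proof.
move=> qt0; rewrite /slice indicE mem_setE in_itv /=.
have [z0|z0] := ltP 0 z.1; last by rewrite mul0r.
rewrite f0; first by rewrite mul0r mulr0.
apply/negP; rewrite negb_and -ltNge (le_lt_trans _ Em0)//.
by rewrite mulr_ge0_le0// ltW.
Qed.

(** The factor 1 / q(t) is the Jacobian of u = E q(t). If q(t) <= 0, then u <= 0 for every E > 0 and
    [f] is zero there, whence the value 0. *)
Definition weighted_moment (t : R) : R :=
  if 0 < q t then A n (Y * q t) / q t else 0.

Let int_slice t : (\int[m]_z (slice z t)%:E = (weighted_moment `|t|)%:E)%E.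
Proof.
rewrite /weighted_moment; case: ltP => qt.
  under eq_integral do rewrite sliceE//.
  rewrite (integral_scale_translation t qt (integrable_J n (Y * q `|t|))).
  by rewrite cumulativeE -EFinM mulrC.
by under eq_integral do rewrite slice0//; rewrite integral0.
Qed.

Let I := (\int[m]_z `|(f z * expR (n%:R * z.2))%:E|)%E.

(** The Jacobian 1/q may blow up near a zero of [q], but the slice vanishes when Y q < Em; otherwise
    1/q <= Y / Em. Hence a bound uniform in [t]. *)
Let int_slice_le t : (\int[m]_z `|(slice z t)%:E| <= (Y / Em)%:E * I)%E.
Proof.
have I0 : (0 <= I)%E by exact: integral_ge0.
have YEm0 : 0 <= Y / Em by rewrite divr_ge0// ltW.
have [qt|qt] := ltP 0 (q `|t|); last first.
  under eq_integral do rewrite slice0// abse0.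
  by rewrite integral0 mule_ge0.
have [YqEm|YqEm] := ltP (Y * q `|t|) Em.
  rewrite (eq_integral (cst 0%E)); first by rewrite integral0 mule_ge0.
  move=> z _; rewrite sliceE// /J indicE mem_setE in_itv /=.
  case: leP => zq; last by rewrite mul0r ?normr0 ?abse0.
  rewrite f0 ?mul0r ?mulr0 ?normr0 ?abse0//.
  by apply/negP; rewrite negb_and -ltNge (le_lt_trans zq).
under eq_integral do rewrite sliceE//.
have /integrableP[mJ _] := integrable_J n (Y * q `|t|).
rewrite (ge0_integral_scale_translation t qt
  (F := fun z => `|(J n (Y * q `|t|) z)%:E|%E))//; last exact: measurableT_comp.
apply: lee_pmul => //; first by rewrite lee_fin invr_ge0 ltW.
- exact: integral_ge0.
- rewrite lee_fin ler_pdivlMr// mulrC ler_pdivrMr//.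
- have /integrableP[mfe _] := f_exp n.
  apply: ge0_le_integral => //; [exact: measurableT_comp|exact: measurableT_comp|].
  move=> z _; rewrite lee_fin /J normrM.
  by rewrite ler_piMl// indicE; case: (_ \in _); rewrite ?normr1 ?normr0.
Qed.

Let kappa_le t : `|kappa t| <= expR (n%:R * w) * K * \1_(`[-w, w]) t.
Proof.
rewrite /kappa indicE mem_setE in_itv /=.
case: (boolP (- w <= t <= w)) => tw; last first.
  by rewrite mul0r normr0 mulr0.
rewrite mul1r mulr1 normrM; apply: ler_pM => //.
  rewrite ger0_norm ?expR_ge0// ler_expR -mulrN ler_wpM2l//.
  by move: tw => /andP[]; rewrite lerNl.
by apply: W2K; rewrite normr_ge0 ler_norml.
Qed.

Let I_fin : I \is a fin_num.
Proof.
have /integrableP[_ Ioo] := f_exp n.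
by rewrite ge0_fin_numE//; exact: integral_ge0.
Qed.

Let integrable_slice t : m.-integrable setT (fun z => (slice z t)%:E).
Proof.
apply/integrableP; split; first exact/measurable_EFinP.
apply: (le_lt_trans (int_slice_le t)).
by rewrite -(fineK I_fin) -EFinM ltry.
Qed.

Let msf : {sigma_finite_measure set (measurableTypeR R * measurableTypeR R)%type -> \bar R} :=
  sigma_finite_product mu mu.

(** Integrating over [z] first, [int_slice_le] bounds the inner integral uniformly, and [kappa] is
    bounded and supported in [-w, w]. *)
Let integrable_G : (msf \x mu)%E.-integrable setT (EFin \o G).
Proof.
have mGe : measurable_fun setT (EFin \o G) by exact/measurable_EFinP.
have fubP := @integrable21ltyP _ _ (measurableTypeR R * measurableTypeR R)%type
  (measurableTypeR R) R msf mu (EFin \o G) mGe.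
apply: fubP.2.
have K0 : 0 <= K.
  by apply: le_trans (W2K (t := 0) _); rewrite ?lexx.
pose C := Y / Em * fine I.
have C0 : 0 <= C by rewrite mulr_ge0// ?fine_ge0 ?integral_ge0// divr_ge0// ltW.
apply: (@le_lt_trans _ _ (\int[mu]_t ((expR (n%:R * w) * K * C)%:E * (\1_(`[-w, w]) t)%:E))%E).
  apply: ge0_le_integral => //.
  - by move=> t _; exact: integral_ge0.
  - apply: (measurable_fun_fubini_tonelli_G (m1 := msf) (fun p => `|(G p)%:E|%E)) => //.
    by apply: measurableT_comp => //; exact/measurable_EFinP.
  - by apply/measurable_EFinP; apply: measurable_funM => //; exact: measurable_indic.
  move=> t _; rewrite /G /=.
  under eq_integral do rewrite normrM EFinM.
  rewrite ge0_integralZl//; last first.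
    by apply/measurable_EFinP; apply: measurableT_comp.
  rewrite -EFinM mulrAC EFinM; apply: lee_pmul => //.
  - exact: integral_ge0.
  - by rewrite lee_fin kappa_le.
  - by rewrite /C EFinM fineK// int_slice_le.
rewrite ge0_integralZl//; last 2 first.
- by apply/measurable_EFinP; exact: measurable_indic.
- by rewrite lee_fin; apply: mulr_ge0 => //; apply: mulr_ge0 => //; exact: expR_ge0.
rewrite integral_indic// setIT /= lebesgue_measure_itv /=.
by case: ifP => _; rewrite ?mule0// -EFinB -EFinM ltry.
Qed.

Let int_G_z t : (\int[m]_z (G (z, t))%:E = (kappa t * weighted_moment `|t|)%:E)%E.
Proof.
rewrite /G /=; under eq_integral do rewrite EFinM.
by rewrite integralZl// int_slice -EFinM.
Qed.

(** The substitution x = t + s turns this integral into the Bragg transform at (E, s), divided by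
    the nonzero constant [c]. *)
Let ae_int_G_t : {ae m, forall z, (\int[mu]_t (G (z, t))%:E = 0)%E}.
Proof.
have intG := @ae_integrable1 _ _ (measurableTypeR R * measurableTypeR R)%type
  (measurableTypeR R) R msf mu (EFin \o G) integrable_G.
have flt : Filter (almost_everywhere msf) by exact: ae_filter_ringOfSetsType.
apply: (@filterS2 _ _ flt _ _ _ _ Bf0 intG) => -[E s] /= BEs iG.
have [EY|EY] := boolP (0 < E <= Y); last first.
  rewrite (eq_integral (cst 0%E)) ?integral0// => t _.
  by rewrite /G /slice /= indicE mem_setE in_itv /= (negPf EY) mul0r mulr0.
have E0 : 0 < E by case/andP: EY.
pose c := W1 E * expR (- (n%:R * s)).
have c0 : c != 0 by rewrite mulf_neq0 ?W1_neq0// gt_eqF ?expR_gt0.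
pose H := (fun x => W E `|x - s| * f (E * q `|x - s|, x)) \_ [set x | `|x - s| <= w].
have GE t : G ((E, s), t) = c^-1 * H (t + s).
  rewrite /H /G /slice /kappa /= !indicE !mem_setE !in_itv /= EY mul1r patchE.
  rewrite (_ : (t + s \in _) = (- w <= t <= w)); last first.
    by rewrite -ler_norml; apply/idP/idP; rewrite inE /= addrK.
  case: ifP => tw; last by rewrite mul0r mul0r mulr0.
  rewrite addrK WE// /c [s + t]addrC !mulrDr expRD expRN expRN.
  rewrite -[true%:R]/(1 : R) mul1r; field.
  by rewrite W1_neq0// !gt_eqF ?expR_gt0.
have HE x : H x = c * G ((E, s), x - s) by rewrite GE subrK mulrA divff// mul1r.
have mHs : measurable_fun setT (fun t => G ((E, s), t)).
  apply: (measurableT_comp mG); exact: measurable_fun_pair.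
have mH : measurable_fun setT (fun x => (H x)%:E).
  apply/measurable_EFinP; rewrite (_ : H = fun x => c * G ((E, s), x - s)); last exact/funext.
  by apply: measurable_funM => //; apply: (measurableT_comp mHs); exact: measurable_funB.
have := BEs E0; rewrite /Rintegral integral_mkcond.
under eq_integral do rewrite restrict_EFin.
rewrite -(integral_translation s mH).
under eq_integral do rewrite HE addrK EFinM.
rewrite integralZl// fineM//; last exact: integrable_fin_num iG.
move/eqP; rewrite mulf_eq0 (negPf c0) /= => /eqP G0.
(* A vanishing [bragg] only says that [fine] of the integral is 0; integrability of the section
   excludes infinite values. *)
by rewrite -[LHS]fineK ?G0//; exact: integrable_fin_num iG.
Qed.

Let int_h0 : (\int[mu]_t (kappa t * weighted_moment `|t|)%:E = 0)%E.
Proof.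
have F := @Fubini _ _ (measurableTypeR R * measurableTypeR R)%type
  (measurableTypeR R) R msf mu (EFin \o G) integrable_G.
transitivity (\int[mu]_t (\int[m]_z (G (z, t))%:E))%E.
  by apply: eq_integral => t _; rewrite int_G_z.
rewrite -[LHS]F (ae_eq_integral (cst 0%E)) ?integral0//.
- by have /integrableP[] := @integrable_fubini_F _ _ (measurableTypeR R * measurableTypeR R)%type
    (measurableTypeR R) R msf mu (EFin \o G) integrable_G.
- by apply: filterS ae_int_G_t => z + _.
Qed.

Let integrable_h : mu.-integrable setT (fun t => (kappa t * weighted_moment `|t|)%:E).
Proof.
have mGe : measurable_fun setT (EFin \o G) by exact/measurable_EFinP.
have fubP := @integrable21ltyP _ _ (measurableTypeR R * measurableTypeR R)%type
  (measurableTypeR R) R msf mu (EFin \o G) mGe.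
have mh := @measurable_fubini_G _ _ (measurableTypeR R * measurableTypeR R)%type
  (measurableTypeR R) R msf mu (EFin \o G) integrable_G.
have hE : fubini_G msf (EFin \o G) = (fun t => (kappa t * weighted_moment `|t|)%:E).
  by apply/funext => t; exact: int_G_z.
rewrite hE in mh; apply/integrableP; split => //.
apply: le_lt_trans (fubP.1 integrable_G); apply: ge0_le_integral => //.
- exact: measurableT_comp.
- apply: (measurable_fun_fubini_tonelli_G (m1 := msf) (fun p => `|(G p)%:E|%E)) => //.
  by apply: measurableT_comp => //; exact/measurable_EFinP.
- move=> t _; rewrite -int_G_z; apply: le_abse_integral => //.
  apply/measurable_EFinP; apply: (measurableT_comp mG).
  exact: measurable_fun_pair.
Qed.

(** The line is folded at 0: [t] and [- t] share every factor but the exponential, and the two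
    exponentials add up to 2 cosh(n t). *)
Lemma bragg_moment_eq0 : (\int[mu]_(t in `[0%R, +oo[)
  (\1_(`[0, w]) t * (W2 t * (expR (n%:R * t) + expR (- (n%:R * t)))) * weighted_moment t)%:E = 0)%E.
Proof.
pose h (t : R) := (kappa t * weighted_moment `|t|)%:E.
have mh : measurable_fun setT h by case/integrableP: integrable_h.
have hN : (\int[mu]_(t in `]-oo, 0%R]) h t = \int[mu]_(t in `[0%R, +oo[) h (- t)%R)%E.
  rewrite integral_mkcond -integral_reflection; last first.
    by apply/(measurable_restrictT _ _).1 => //; exact: measurable_funTS.
  rewrite [RHS]integral_mkcond; apply: eq_integral => t _.
  by rewrite !patchE !mem_setE !in_itv /= andbT oppr_le0.
have mhN : measurable_fun setT (fun t : R => h (- t)) by exact: measurableT_comp.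
have ihN : mu.-integrable setT (fun t => h (- t)).
  apply/integrableP; split => //.
  rewrite (integral_reflection (F := fun t => `|h t|%E)); last exact: measurableT_comp.
  by case/integrableP: integrable_h.
rewrite -[RHS]int_h0 (_ : setT = `]-oo, 0%R] `|` `]0%R, +oo[); last first.
  apply/esym/seteqP; split => // t _; rewrite /= !in_itv /= andbT.
  by case: (leP t 0); [left|right].
rewrite integral_setU//; last 2 first.
- exact: measurable_funTS.
- by apply/disj_setPS => t [] /=; rewrite !in_itv /= andbT leNgt => /negP.
rewrite hN integral_itv_obnd_cbnd; last exact: measurable_funTS.
rewrite -integralD//; last 2 first.
- exact: integrableS ihN.
- exact: integrableS integrable_h.
apply: eq_integral => t; rewrite inE /= in_itv /= andbT => t0.
rewrite -EFinD normrN (ger0_norm t0) -mulrDl /kappa !indicE !mem_setE !in_itv /=.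
rewrite t0 lerN2 normrN (ger0_norm t0) mulrN opprK.
have wt : - w <= t by rewrite (le_trans _ t0)// oppr_le0.
have tw : - t <= w by rewrite (le_trans _ w0)// oppr_le0.
rewrite wt tw /= andbT; congr (_ * _)%:E; ring.
Qed.

End reduction.

(** * One-sided derivatives *)

Section class_C_C1_pair.
Context {R : realType}.
Implicit Types (D : set R) (f : R -> R).

(** Variant of [within_increments_open] for interior points of a set that need not be open, such as
    [0, +oo[. *)
Lemma within_increments_nbhs D x : nbhs x D ->
  within [set h | D (h + x)] 0^' = 0^'.
Proof.
move=> Dx.
have H : \forall h \near (0 : R)^', D (h + x).
  apply: nbhs_dnbhs; move/nbhs0P: Dx => /=.
  by apply: filterS => h; rewrite addrC.
apply/seteqP; split => P; rewrite /within /= => hP; near=> h.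
- have : D (h + x) by near: h.
  by near: h.
- by move=> _; near: h.
Unshelve. all: by end_near. Qed.

(** The increment of [f] is [h] times a convergent difference quotient, so it tends to 0 with
    [h]. *)
Lemma derivable_on_continuous D f : (forall x, D x -> derivable_on D f x) ->
  {within D, continuous f}.
Proof.
move=> dF; apply/subspace_continuousP => x /dF /cvg_ex[/= l fl].
apply/cvgrPdist_le => e e0.
have FF : Filter (within [set h | D (h + x)] (0 : R)^') by exact: within_filter.
have h0 : h @[h --> within [set h | D (h + x)] 0^'] --> (0 : R).
  by apply: cvg_within_filter; exact: nbhs_dnbhs.
have := cvgM h0 fl; rewrite mul0r => /(_ FF) /cvgrPdist_le /(_ e e0).
move=> H; have {}H : nbhs (0 : R) (fun h : R => h != 0 -> D (h + x) ->
    `|0 - h * (h^-1 *: (f (h + x) - f x))| <= e) by exact: H.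
apply: (nbhs0P (fun t : R => D t -> `|f x - f t| <= e) (x : R)).2.
move: H; apply: filterS => h hE Dh.
have [->|hn0] := eqVneq h 0; first by rewrite addr0 subrr normr0 ltW.
move: (hE hn0); rewrite [h + x]addrC => /(_ Dh).
by rewrite sub0r normrN /GRing.scale /= mulVKf// distrC.
Qed.

(** Points of ]a, b[ are interior to [D], where [derive_on] is the usual derivative; the endpoints
    require continuity only. *)
Lemma class_C1_pair D f (a b : R) : `[a, b] `<=` D -> class_C 1 D f ->
  C1_pair a b f (derive_on D f).
Proof.
move=> abD [dF cF]; split.
- exact: continuous_subspaceW (derivable_on_continuous dF).
- exact: continuous_subspaceW cF.
move=> t tab; have tD : nbhs t D.
  apply: (@filterS _ _ _ `]a, b[%classic).
    by move=> u /subset_itv_oo_cc; exact: abD.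
  by apply: open_nbhs_nbhs; split => //; exact: interval_open.
have E : (fun h : R => h^-1 *: (f (h + t) - f t)) =
    (fun h : R => h^-1 *: ((f \o shift t) (h *: (1 : R)) - f t)).
  by apply/funext => h /=; rewrite [h%:A]mulr1.
have dft : derivable f t 1.
  move: (dF t (nbhs_singleton tD)).
  by rewrite /derivable_on (within_increments_nbhs tD) E.
apply: DeriveDef; first exact: dft.
by rewrite -derive1E /derive_on (within_increments_nbhs tD).
Qed.

Lemma class_C2_C1 D f : class_C 2 D f ->
  class_C 1 D f /\ class_C 1 D (derive_on D f).
Proof.
by move=> [dF [ddF cF]]; split; split => //; exact: derivable_on_continuous.
Qed.

(** Serves to make q(|t|) and W2(|t|) measurable on the whole line. One-sided continuity at 0
    suffices because |t| >= 0. *)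
Lemma continuous_comp_normr f : {within `[0, +oo[, continuous f} ->
  continuous (fun t : R => f `|t|).
Proof.
move=> /subspace_continuousP cf x.
apply: (@cvg_comp _ _ _ (fun y : R => `|y| : R) f _
  (within `[0, +oo[%classic (nbhs (`|x| : R)))); last first.
  by apply: cf; rewrite /= in_itv /= normr_ge0.
have nc : {for x, continuous (fun y : R => `|y|)} by exact: norm_continuous.
move=> P hP.
have {}hP : nbhs (`|x| : R) (fun y : R => `[0, +oo[%classic y -> P y) by exact: hP.
have {}hP : nbhs x (fun y : R => `[0, +oo[%classic `|y| -> P `|y|) := nc _ hP.
change (nbhs x (fun y : R => P `|y|)); apply: filterS hP => y; apply.
by rewrite /= in_itv /= normr_ge0.
Qed.

End class_C_C1_pair.

(** * Almost everywhere on a product *)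

Section almost_everywhere_product.
Context {R : realType}.
Local Notation mu := (@lebesgue_measure R).
Local Notation m := (mu \x mu)%E.

(** The measure of a set is the integral of those of its sections, so almost all sections of a null
    set are null. *)
Lemma ae_product (P : R * R -> Prop) : {ae m, forall z, P z} ->
  {ae mu, forall u, {ae mu, forall x, P (u, x)}}.
Proof.
move=> [N [mN N0 PN]].
have mx : measurable_fun setT (mu \o xsection N) by exact: measurable_fun_xsection.
have : (\int[mu]_u `|mu (xsection N u)| = 0)%E.
  by rewrite -[RHS]N0; apply: eq_integral => u _; rewrite gee0_abs.
move=> /(ae_eq_integral_abs mu measurableT mx).
apply: filterS => u /(_ I) /= Nu0.
exists (xsection N u); split => //; first exact: measurable_xsection.
by move=> x /= Px; rewrite /xsection /= inE; exact: PN.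
Qed.

Lemma ae_eq0_sections (f : measurableTypeR R * measurableTypeR R -> R) : measurable_fun setT f ->
  {ae mu, forall u, {ae mu, forall x, f (u, x) = 0}} ->
  {ae m, forall z, f z = 0}.
Proof.
move=> mf f0.
have mef : measurable_fun setT (EFin \o f) by exact/measurable_EFinP.
have : (\int[m]_z `|(EFin \o f) z| = 0)%E.
  rewrite (fubini_tonelli1 (fun z => `|(EFin \o f) z|%E))//; last exact: measurableT_comp.
  rewrite (ae_eq_integral (cst 0%E)) ?integral0//.
    by apply: measurable_fun_fubini_tonelli_F => //; exact: measurableT_comp.
  apply: filterS f0 => u fu0 _; rewrite /fubini_F.
  rewrite (ae_eq_integral (cst 0%E)) ?integral0//.
    have mpair : measurable_fun setT
        (fun x : measurableTypeR R => (u : measurableTypeR R, x)).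
      exact: measurable_fun_pair.
    have mfu := measurableT_comp mf mpair.
    by apply: measurableT_comp => //; exact/measurable_EFinP.
  by apply: filterS fu0 => x /= -> _; rewrite normr0.
move=> /(ae_eq_integral_abs m measurableT mef); apply: filterS => z /(_ I) /=.
by move=> [].
Qed.

End almost_everywhere_product.

(** * Compactly supported square-integrable functions *)

Section L2_0_integrability.
Context {R : realType}.
Local Notation mu := (@lebesgue_measure R).
Local Notation m := (mu \x mu)%E.
Variables (Omega : set (R * R)) (f : R * R -> R).
Hypothesis Lf : L2_0 Omega f.

Lemma L2_0_measurable :
  measurable_fun setT (f : measurableTypeR R * measurableTypeR R -> R).
Proof.
have [Lf2 _ _] := Lf.
by move: Lf2; rewrite inE => /andP[]; rewrite !inE.
Qed.

Lemma L2_0_support : exists2 B : R, 0 <= B &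
  {ae m, forall z, B < `|z.1| \/ B < `|z.2| -> f z = 0}.
Proof.
have [_ _ [K [cK _ f0]]] := Lf.
have [B [_ HB]] := compact_bounded cK.
(* Every number greater than [B] bounds [K]; this one is also nonnegative. *)
exists (`|B| + 1); first by rewrite addr_ge0.
apply: filterS f0 => z /= + Bz; apply => Kz.
have : `|z| <= `|B| + 1 by apply: HB => //; rewrite (le_lt_trans (ler_norm B))// ltrDl.
rewrite prod_normE ge_max => /andP[z1 z2].
by case: Bz; rewrite ltNge ?z1 ?z2.
Qed.

(** On a box of finite measure, |f| <= 1 + f^2 and the exponential is at most e^(n B); off the box
    [f] vanishes almost everywhere. *)
Lemma L2_0_integrable_exp (n : nat) :
  m.-integrable setT (fun z => (f z * expR (n%:R * z.2))%:E).
Proof.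
have mf := L2_0_measurable.
have [Lf2 _ _] := Lf; have f2 := Lfun2_integrable_sqr Lf2.
have [B B0 fB] := L2_0_support.
pose Q : set (measurableTypeR R * measurableTypeR R) := `[- B, B] `*` `[- B, B].
have mQ : measurable Q by exact: measurableX.
have me : measurable_fun setT
    (fun z : measurableTypeR R * measurableTypeR R => expR (n%:R * z.2)).
  by apply: measurableT_comp => //; exact: measurable_funM.
have mfe : measurable_fun setT
    (fun z : measurableTypeR R * measurableTypeR R => f z * expR (n%:R * z.2)).
  exact: measurable_funM.
pose IB : set R := `[- B, B]%classic.
have muB : (mu IB < +oo)%E.
  by rewrite /IB lebesgue_measure_itv /=; case: ifP => // _; rewrite -EFinB ltry.
have mQfin : (m Q < +oo)%E.
  by rewrite product_measure1E// lte_mul_pinfty// ge0_fin_numE.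
have i1f : m.-integrable Q (fun z => (expR (n%:R * B))%:E * ((1 : R)%:E + (f z ^+ 2)%:E))%E.
  apply: integrableZl => //; apply: integrableD => //.
    apply/integrableP; split; first exact: measurable_cst.
    rewrite (_ : (fun z => _) = cst 1%:E) ?integral_cst ?mul1e//.
    by apply/funext => z; rewrite /= normr1.
  exact: integrableS f2.
have ifQ : m.-integrable Q (fun z => (f z * expR (n%:R * z.2))%:E).
  apply: le_integrable i1f => //.
    by apply/measurable_EFinP; exact: measurable_funTS.
  move=> z [_ /=]; rewrite in_itv /= => /andP[_ zB].
  rewrite lee_fin normrM mulrC [leRHS]normrM.
  apply: ler_pM => //.
    by rewrite !ger0_norm ?expR_ge0// ler_expR ler_wpM2l.
  rewrite [leRHS]ger0_norm ?addr_ge0 ?sqr_ge0// -real_normK ?num_real//.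
  (* This square gives |f| <= f^2 + 1/4. *)
  have := sqr_ge0 (`|f z| - 2^-1); rewrite sqrrB => h.
  by nra.
have /integrableP[_ fQoo] := ifQ.
apply/integrableP; split; first exact/measurable_EFinP.
rewrite (le_lt_trans _ fQoo)// [leRHS]integral_mkcond le_eqVlt; apply/orP; left; apply/eqP.
apply: ge0_ae_eq_integral => //.
- by apply: measurableT_comp => //; exact/measurable_EFinP.
- apply/(measurable_restrictT _ _).1 => //; apply: measurable_funTS.
  by apply: measurableT_comp => //; exact/measurable_EFinP.
- by move=> z _; rewrite erestrict_ge0.
have flt : Filter (almost_everywhere m).
  exact: (ae_filter_ringOfSetsType (sigma_finite_product mu mu)).
apply: (@filterS _ _ flt _ _ _ fB) => z fz _; rewrite patchE; case: ifPn => // /negP zQ.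
rewrite fz ?mul0r ?abse0//.
apply: contrapT => zB; apply: zQ; rewrite inE.
split; rewrite /= in_itv /= -ler_norml leNgt; apply/negP => Bz; apply: zB; [left|right]; exact: Bz.
Qed.

End L2_0_integrability.

(** * Functions on the plane whose sections have vanishing exponential moments *)

Section moments_determine.
Context {R : realType}.
Local Notation mu := (@lebesgue_measure R).
Local Notation m := (mu \x mu)%E.

Lemma exp_moments_eq0 (f : R * R -> R) (B : R) :
  measurable_fun setT (f : measurableTypeR R * measurableTypeR R -> R) ->
  {ae m, forall z, B < `|z.2| -> f z = 0} ->
  (forall n : nat, m.-integrable setT (fun z => (f z * expR (n%:R * z.2))%:E)) ->
  {ae mu, forall u, forall n, exp_moment f n u = 0} ->
  {ae m, forall z, f z = 0}.
Proof.
move=> mf fB f_exp phi0; apply: ae_eq0_sections => //.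
have ae_int : {ae mu, forall u, forall n : nat,
    mu.-integrable setT (fun x => (f (u, x) * expR (n%:R * x))%:E)}.
  by apply/ae_foralln => n; have := ae_integrable1 (f_exp n).
have flt : Filter (almost_everywhere mu) by exact: (ae_filter_ringOfSetsType mu).
apply: (@filterS3 _ _ flt _ _ _ _ _ phi0 ae_int (ae_product fB)) => u {}phi0 int_f fuB.
(* [ae_eq0_moments] wants a function that is zero everywhere beyond [B]; the section is so only
   almost everywhere, hence the truncation. *)
pose F x := if `|x| <= B then f (u, x) else 0.
have mpair : measurable_fun setT (fun x : measurableTypeR R => (u : measurableTypeR R, x)).
  exact: measurable_fun_pair.
have mfu := measurableT_comp mf mpair.
have mF : measurable_fun setT F.
  apply: measurable_fun_ifT => //.
  by apply: measurable_fun_ler => //.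
have FE : {ae mu, forall x, F x = f (u, x)}.
  apply: (@filterS _ _ flt _ _ _ fuB) => x fx; rewrite /F; case: leP => // /fx ->//.
have F0 : {ae mu, forall x, F x = 0}.
  apply: (@ae_eq0_moments _ F B).
  - have := int_f 0%N; under eq_fun do rewrite mul0r expR0 mulr1.
    apply: le_integrable => //; first exact/measurable_EFinP.
    by move=> x _; rewrite /= lee_fin /F; case: ifP => // _; rewrite normr0.
  - by move=> x; rewrite /F ltNge => /negPf ->.
  - move=> n; rewrite (ae_eq_integral
      (fun x : measurableTypeR R => (f (u, x) * expR (n%:R * x))%:E)) //.
    + rewrite -[LHS]fineK; last exact: integrable_fin_num.
      by have := phi0 n; rewrite /exp_moment /Rintegral => ->.
    + apply/measurable_EFinP; apply: measurable_funM => //.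
      by apply: measurableT_comp => //; exact: measurable_funM.
    + by case/integrableP: (int_f n).
    + by apply: (@filterS _ _ flt _ _ _ FE) => x -> _.
by apply: (@filterS2 _ _ flt _ _ _ _ FE F0) => x ->.
Qed.

End moments_determine.

(** * Injectivity *)

Section vanishing_cumulative_moments.
Context {R : realType}.
Local Notation mu := (@lebesgue_measure R).
Local Notation m := (mu \x mu)%E.

Lemma C1_pair_cosh (n : nat) (a b : R) :
  C1_pair a b (fun t => expR (n%:R * t) + expR (- (n%:R * t)))
    (fun t => (expR (n%:R * t) - expR (- (n%:R * t))) * n%:R).
Proof.
have C1n : C1_pair a b (fun t => n%:R * t) (fun=> n%:R : R).
  have := C1_pairM (C1_pair_cst a b n%:R) (C1_pair_id a b).
  by under [X in C1_pair a b _ X]eq_fun do rewrite mul0r add0r mulr1.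
have cN : continuous (fun x : R => expR (- x)).
  move=> x; apply: (cvg_comp (fun y : R => - y) expR); last exact: continuous_expR.
  exact: opp_continuous.
apply: (C1_pair_comp (G := fun x => expR x + expR (- x))
  (G' := fun x => expR x - expR (- x)) C1n) => t _.
- by apply: cvgD; [exact: continuous_expR|exact: cN].
- by apply: cvgB; [exact: continuous_expR|exact: cN].
- have dN : is_derive (n%:R * t) (1 : R) (fun x : R => expR (- x)) (expR (- (n%:R * t)) * -1).
    exact: (is_derive1_comp (f := expR) (g := -%R)).
  have := is_deriveD (is_derive_expR (n%:R * t)) dN.
  by rewrite mulrN1.
Qed.

Variables (Em EM w K c1 c2 a b d e s : R) (q W1 W2 : R -> R) (W : R -> R -> R).
Variable f : R * R -> R.
Local Notation D := (`[0, +oo[%classic : set R).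
Local Notation q' := (derive_on D q).
Hypotheses (Em0 : 0 < Em) (EmEM : Em < EM) (c20 : 0 < c2).
Hypotheses (a0 : 0 <= a) (ab : a < b) (bw : b <= w).
Hypothesis Cq : class_C 2 D q.
Hypothesis CW2 : class_C 1 setT W2.
Hypothesis WE : forall E t : R, 0 < E -> W E t = W1 E * W2 t.
Hypothesis W1_neq0 : forall E : R, 0 < E -> W1 E != 0.
Hypothesis W2_neq0 : forall t : R, W2 t != 0.
Hypothesis W2K : forall t : R, 0 <= t <= w -> `|W2 t| <= K.
Hypothesis c1E : c1 = c2 * Em / EM.
Hypothesis s_de : [/\ s = 1, d = b & e = a] \/ [/\ s = - 1, d = a & e = b].
Hypotheses (qd : q d = c2) (qe : q e = c1).
Hypothesis q_bnd : forall t : R, a <= t <= b -> 0 < q t <= c2.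
Hypothesis q'_gt0 : forall t : R, a <= t <= b -> 0 < s * q' t.
Hypothesis q_out : forall t : R, 0 <= t <= w -> ~~ (a <= t <= b) -> q t <= c1.
Hypothesis mf : measurable_fun setT (f : measurableTypeR R * measurableTypeR R -> R).
Hypothesis f0 : forall u s, ~ Em <= u <= EM -> f (u, s) = 0.
Hypothesis f_exp : forall n : nat,
  m.-integrable setT (fun z => (f z * expR (n%:R * z.2))%:E).
Hypothesis Bf0 : {ae m, forall z, 0 < z.1 -> bragg q W w f z = 0}.

(** On [0, w] off [a, b], [q_out] gives q(t) <= c1, so Y q(t) <= Em wherever q(t) > 0 and the
    integrand vanishes. Thus [bragg_moment_eq0] becomes the Volterra equation on [a, b]. *)
Lemma cumulative_moment_eq0 (n : nat) (v : R) : v < EM -> cumulative_moment f n v = 0.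
Proof.
have abD : `[a, b] `<=` D.
  by move=> t; rewrite /= !in_itv /= andbT => /andP[/(le_trans a0)].
have [Cq1 Cq'] := class_C2_C1 Cq.
have C1q := class_C1_pair abD Cq1.
(* [H] below contains 1/q', so [H'] involves the second derivative of [q]. *)
have C1q' := class_C1_pair abD Cq'.
have C1W2 : C1_pair a b W2 (derive_on setT W2) by exact: class_C1_pair.
have q_neq0 t : a <= t <= b -> q t != 0 by move=> /q_bnd /andP[/gt_eqF ->].
have q'_neq0 t : a <= t <= b -> q' t != 0.
  by move=> /q'_gt0; apply: contraTneq => ->; rewrite mulr0 ltxx.
(* Dividing by [q'] makes H q' A_n(Y q) the integrand of [bragg_moment_eq0]. *)
pose H t := W2 t * (expR (n%:R * t) + expR (- (n%:R * t))) * ((q t)^-1 * (q' t)^-1).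
have C1H := C1_pairM (C1_pairM C1W2 (C1_pair_cosh n a b))
  (C1_pairM (C1_pairV q_neq0 C1q) (C1_pairV q'_neq0 C1q')).
have dab : a <= d <= b by case: s_de => -[_ -> _]; rewrite lexx ?andbT /= ltW.
have EM0 : 0 < EM by exact: lt_trans EmEM.
have w0 : 0 <= w by rewrite (le_trans a0)// (le_trans (ltW ab)).
apply: (volterra_inj (H := H) ab Em0 EmEM c20 c1E s_de qd qe q_bnd q'_gt0 C1q _ C1H).
- by move=> u; exact: (continuous_cumulative_moment Em0 f0 f_exp).
- by rewrite /H !mulf_neq0 ?invr_neq0 ?q_neq0 ?q'_neq0// gt_eqF// addr_gt0 ?expR_gt0.
- by move=> u; exact: (cumulative_moment_out f0 f_exp).
move=> Y Y0 YEM.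
have mq : measurable_fun setT (fun t : measurableTypeR R => q `|t|).
  apply: continuous_measurable_fun; apply: continuous_comp_normr.
  by case: Cq1 => dq _; exact: derivable_on_continuous.
have mW2 : measurable_fun setT (fun t : measurableTypeR R => W2 `|t|).
  apply: continuous_measurable_fun; apply: continuous_comp_normr.
  case: CW2 => dW2 _; apply: continuous_subspaceW (derivable_on_continuous dW2).
  exact: subsetT.
have := bragg_moment_eq0 Em0 w0 WE W1_neq0 mq mW2 W2K mf f0 f_exp Bf0 n Y0.
rewrite /Rintegral => B0; rewrite -[RHS](congr1 fine B0); congr fine.
rewrite [LHS]integral_mkcond [RHS]integral_mkcond; apply: eq_integral => t _.
rewrite !patchE !mem_setE !in_itv /= andbT indicE mem_setE in_itv /=.
have [tab|tab] := boolP (a <= t <= b).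
  have /andP[at_ tb] := tab.
  rewrite (le_trans a0 at_) (le_trans tb bw) /= mul1r /weighted_moment.
  have /andP[qt0 _] := q_bnd tab.
  rewrite qt0 /H; congr EFin; field.
  by rewrite q_neq0// q'_neq0.
have [t0|//] := leP 0 t.
have [tw|_] := leP t w; last by rewrite mul0r mul0r.
rewrite /weighted_moment; case: ifP => [qt0|]; last by rewrite mulr0.
rewrite (cumulative_moment_out f0 f_exp) ?mul0r ?mulr0//.
have qc1 : q t <= c1 by apply: q_out => //; rewrite t0.
rewrite (le_trans (_ : _ <= EM / c2 * c1))//.
  by apply: ler_pM => //; exact: ltW.
rewrite c1E le_eqVlt; apply/orP; left; apply/eqP.
by field; rewrite (gt_eqF c20) (gt_eqF EM0).
Qed.

End vanishing_cumulative_moments.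

Theorem theorem5p2 (R : realType) (Em EM w : R) (q1 g W1 W2 : R -> R)
  (W : R -> R -> R)
  (hEm : 0 < Em) (hEM : Em < EM) (hw : 0 < w)
  (hq1 : class_C 2 `[0, +oo[ q1)
  (hmono : strictly_increasing_on `[0, +oo[ q1 \/
           strictly_decreasing_on `[0, +oo[ q1)
  (hg : forall t, 0 <= t -> g (q1 t) = t)
  (hW : forall E t, 0 < E -> W E t = W1 E * W2 t)
  (hW1 : class_C 1 `]0, +oo[ W1)
  (hW2 : class_C 1 setT W2)
  (hW1_neq0 : forall E, 0 < E -> W1 E != 0)
  (hW2_neq0 : forall t, W2 t != 0)
  (hW2_bnd : exists M, forall t, - w <= t <= w -> `|W2 t| <= M)
  (hdW2_bnd : exists M, forall t, - w <= t <= w -> `|derive1 W2 t| <= M)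
  (hcond :
    (let c2 := q1 w in
     let c1 := c2 * Em / EM in
     [/\ strictly_increasing_on `[0, +oo[ q1,
         q1 0 = 0 &
         forall t, g c1 <= t <= w -> 0 < derive_on `[0, +oo[ q1 t])
    \/
    (let c2 := q1 0 in
     let c1 := c2 * Em / EM in
     [/\ strictly_decreasing_on `[0, +oo[ q1,
         0 < q1 0,
         (exists2 l : \bar R, (l < 0)%E & (q1 t)%:E @[t --> +oo] --> l),
         g 0 < w &
         forall t, 0 <= t <= g c1 -> derive_on `[0, +oo[ q1 t < 0])) :
  forall f : R * R -> R,
    L2_0 (`[Em, EM] `*` setT) f ->
    ae_eq (lebesgue_measure \x lebesgue_measure)%E (`]0, +oo[ `*` setT)
      (bragg q1 W w f) (cst 0) ->
    ae_eq (lebesgue_measure \x lebesgue_measure)%E (`[Em, EM] `*` setT)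
      f (cst 0).
Proof.
move=> f Lf Bf.
have mf := L2_0_measurable Lf.
have [B B0 fB] := L2_0_support Lf.
have f_exp := L2_0_integrable_exp Lf.
have f0 u s : ~ Em <= u <= EM -> f (u, s) = 0.
  have [_ fO _] := Lf; move=> uE; apply: fO => -[/= + _].
  by rewrite in_itv.
have [K W2K] := hW2_bnd.
have {}W2K t : 0 <= t <= w -> `|W2 t| <= K.
  by move=> /andP[t0 tw]; rewrite W2K// tw (le_trans _ t0)// oppr_le0 ltW.
have EM0 : 0 < EM := lt_trans hEm hEM.
have Bf0 : {ae (lebesgue_measure \x lebesgue_measure)%E,
    forall z, 0 < z.1 -> bragg q1 W w f z = 0}.
  apply: filterS Bf => z Bz z0; apply: Bz; split => //=.
  by rewrite in_itv /= z0.
have cq1 : {within `[0, +oo[, continuous q1}.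
  by have [[dq _] _] := class_C2_C1 hq1; exact: derivable_on_continuous.
have cq (T : R) : {within `[0, T], continuous q1}.
  apply: continuous_subspaceW cq1 => t /=; rewrite !in_itv /= andbT.
  by move=> /andP[].
have A0 n v : v < EM -> cumulative_moment f n v = 0.
  case: hcond => /=.
  - set c2 := q1 w; set c1 := c2 * Em / EM => -[inc q0 dq].
    have lei x y : 0 <= x -> x <= y -> q1 x <= q1 y.
      move=> x0; rewrite le_eqVlt => /predU1P[->//|xy].
      by apply/ltW/inc; rewrite //= in_itv /= andbT// (le_trans x0)// ltW.
    have c20 : 0 < c2.
      by rewrite -q0; apply: inc => //=; rewrite in_itv /= andbT// ltW.
    have c10 : 0 < c1 by rewrite divr_gt0// mulr_gt0.
    have c12 : c1 < c2 by rewrite ltr_pdivrMr// ltr_pM2l.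
    (* [g] is only known on values of [q1], so a preimage of [c1] is found first and then identified
       with [g c1]. *)
    have [t0 t0w qt0] : exists2 t0, t0 \in `[0, w] & q1 t0 = c1.
      apply: IVT; [exact: ltW|exact: cq|].
      by rewrite q0 -/c2 (min_idPl (ltW c20)) (max_idPr (ltW c20)) (ltW c10) ltW.
    move: t0w; rewrite in_itv /= => /andP[t00 t0w].
    have gc1 : g c1 = t0 by rewrite -qt0 hg.
    have t0w' : t0 < w.
      by rewrite lt_neqAle t0w andbT; apply: contraTneq c12 => t0E; rewrite -qt0 t0E ltxx.
    rewrite gc1 in dq.
    apply: (@cumulative_moment_eq0 R Em EM w K c1 c2 t0 w w t0 1 q1 W1 W2 W f) => //.
    + by left.
    + move=> t /andP[t0t tw]; rewrite lei// ?(le_trans t00)// andbT.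
      by rewrite (lt_le_trans c10)// -qt0 lei.
    + by move=> t /dq; rewrite mul1r.
    + move=> t /andP[tge tw]; rewrite tw andbT -ltNge => /ltW tt0.
      by rewrite -qt0 lei.
  - set c2 := q1 0; set c1 := c2 * Em / EM => -[dec c20 [l l0 ql] g0w dq].
    have lei x y : 0 <= x -> x <= y -> q1 y <= q1 x.
      move=> x0; rewrite le_eqVlt => /predU1P[->//|xy].
      by apply/ltW/dec; rewrite //= in_itv /= andbT// (le_trans x0)// ltW.
    have c10 : 0 < c1 by rewrite divr_gt0// mulr_gt0.
    have c12 : c1 < c2 by rewrite ltr_pdivrMr// ltr_pM2l.
    have [T T0 qT] : exists2 T, 0 <= T & q1 T < 0.
      have q_lt0 : pinfty_nbhs R (fun t => q1 t < 0).
        (* A neighbourhood in the extended reals, which covers a limit equal to -oo. *)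
        have /ql : nbhs l [set y | (y < 0)%E].
          by apply: open_nbhs_nbhs; split => //; exact: open_ereal_lt_ereal.
        by move=> [M [Mr HM]]; exists M; split => // t /HM; rewrite /= lte_fin.
      have [T [qT T0]] := filter_ex (filterI q_lt0 (nbhs_pinfty_ge (num_real 0))).
      by exists T.
    (* This zero is [g 0], hence less than [w]; the value [c1] is then attained on [0, z0], inside
       [0, w]. *)
    have [z0 z0T qz0] : exists2 z0, z0 \in `[0, T] & q1 z0 = 0.
      apply: IVT => //; rewrite -/c2.
      have qTc2 := lt_trans qT c20.
      by rewrite (min_idPr (ltW qTc2)) (max_idPl (ltW qTc2)) (ltW qT) ltW.
    move: z0T; rewrite in_itv /= => /andP[z00 _].
    have gz0 : g 0 = z0 by rewrite -qz0 hg.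
    rewrite gz0 in g0w.
    have [t0 t0z qt0] : exists2 t0, t0 \in `[0, z0] & q1 t0 = c1.
      apply: IVT; [exact: z00|exact: cq|].
      by rewrite qz0 -/c2 (min_idPr (ltW c20)) (max_idPl (ltW c20)) (ltW c10) ltW.
    move: t0z; rewrite in_itv /= => /andP[t00 t0z].
    have gc1 : g c1 = t0 by rewrite -qt0 hg.
    have t0gt0 : 0 < t0.
      by rewrite lt_neqAle t00 andbT; apply: contraTneq c12 => t0E; rewrite -qt0 -t0E ltxx.
    rewrite gc1 in dq.
    (* Now [q1] is largest at the left end of the segment [0, t0], whence [d = 0], [e = t0] and the
       sign -1. *)
    apply: (@cumulative_moment_eq0 R Em EM w K c1 c2 0 t0 0 t0 (- 1) q1 W1 W2 W f) => //.
    + by rewrite (le_trans t0z)// ltW.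
    + by right.
    + move=> t /andP[tge tt0]; rewrite lei// andbT.
      by rewrite (lt_le_trans c10)// -qt0 lei.
    + by move=> t /dq; rewrite mulN1r oppr_gt0.
    + move=> t /andP[tge tw]; rewrite tge /= -ltNge => /ltW t0t.
      by rewrite -qt0 lei.
have phi0 : {ae lebesgue_measure, forall u, forall n, exp_moment f n u = 0}.
  apply/ae_foralln => n.
  have phin := ae_eq0_primitive (open_lt (y := EM)) (integrable_exp_moment f_exp n) (A0 n).
  (* [phin] covers u < EM and [exp_moment_out] covers u > EM; the remaining point is a null set. *)
  have nEM : {ae lebesgue_measure, forall u : R, u != EM}.
    exists [set EM]; split => //; first exact: lebesgue_measure_set1.
    by move=> u /= /negP; rewrite negbK => /eqP.
  have flt : Filter (almost_everywhere (@lebesgue_measure R)).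
    exact: (ae_filter_ringOfSetsType lebesgue_measure).
  apply: (@filterS2 _ _ flt _ _ _ _ phin nEM) => u phiu uEM.
  have [/phiu//|EMu] := ltP u EM.
  apply: (exp_moment_out f0); apply/negP; rewrite negb_and -!ltNge.
  by rewrite [EM < u]lt_neqAle EMu eq_sym uEM orbT.
have fltm : Filter (almost_everywhere (@lebesgue_measure R \x @lebesgue_measure R)%E).
  exact: (ae_filter_ringOfSetsType
    (sigma_finite_product (@lebesgue_measure R) (@lebesgue_measure R))).
have fB2 : {ae (lebesgue_measure \x lebesgue_measure)%E, forall z, B < `|z.2| -> f z = 0}.
  by apply: (@filterS _ _ fltm _ _ _ fB) => z + Bz; apply; right.
by apply: (@filterS _ _ fltm _ _ _ (exp_moments_eq0 mf fB2 f_exp phi0)) => z fz _.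
Qed.
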